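(* Let $\mathcal{F}_{2,A,B}(x)=x^{4}+Ax^{3}+Bx^{2}+Ax+1$ for $A,B\in\mathbb{Z}$. There exist infinitely many pairs $(A,B)\in\mathbb{Z}^2$ with $A\equiv B\equiv 1\pmod 4$ such that $\mathcal{F}_{2,A,B}(x)$ is monogenic with Galois group over $\mathbb{Q}$ isomorphic to $D_4$. Furthermore, for any two such pairs $(A_i,B_i)\neq(A_j,B_j)$ (i.e. with $A_i\equiv B_i\equiv A_j\equiv B_j\equiv 1\pmod 4$, $\mathcal{F}_{2,A_i,B_i}$ and $\mathcal{F}_{2,A_j,B_j}$ monogenic with Galois group $D_4$), if $\mathcal{F}_{2,A_i,B_i}(\theta_i)=\mathcal{F}_{2,A_j,B_j}(\theta_j)=0$, then $\mathbb{Q}(\theta_i)\neq\mathbb{Q}(\theta_j)$.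
   Context: A monic polynomial $f(x)\in\mathbb{Z}[x]$ is called monogenic if $f(x)$ is irreducible over $\mathbb{Q}$ and $\{1,\theta,\ldots,\theta^{\deg f-1}\}$ is a $\mathbb{Z}$-basis of the ring of integers of $\mathbb{Q}(\theta)$, where $f(\theta)=0$. $D_4$ denotes the dihedral group of order $8$. *)

(* Defs.v *)
From HB Require Import structures.
From mathcomp Require Import all_boot all_order all_algebra all_fingroup.
From mathcomp Require Import all_solvable all_field.
From mathcomp Require Import boolp classical_sets functions cardinality.

Set Implicit Arguments.
Unset Strict Implicit.
Unset Printing Implicit Defensive.

Import Order.TTheory GRing.Theory Num.Theory.
Local Open Scope ring_scope.

Definition ring_of_integers (L : fieldExtType rat) (K : {vspace L}) (x : L) :
    Prop :=
  x \in K /\ integralOver (intr : int -> L) x.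

Definition Z_basis (V : zmodType) (n : nat) (b : 'I_n -> V) (M : V -> Prop) :
    Prop :=
  [/\ forall i, M (b i),
      forall c : 'I_n -> int, \sum_(i < n) b i *~ c i = 0 -> forall i, c i = 0
    & forall x, M x -> exists c : 'I_n -> int, x = \sum_(i < n) b i *~ c i].

(* [size f] is one more than the degree, and [<<1; theta>>] is the subfield    *)
(* Q(theta). The root theta ranges over all finite extensions of Q; one        *)
(* containing a root exists because an irreducible f is not constant.          *)
Definition monogenic (f : {poly int}) : Prop :=
  [/\ f \is monic,
      irreducible_poly (map_poly intr f : {poly rat})
    & forall (L : fieldExtType rat) (theta : L),
        root (map_poly intr f) theta ->
        Z_basis (fun i : 'I_(size f).-1 => theta ^+ i)
                (ring_of_integers <<1; theta>>%VS)].

Definition galois_group_is (f : {poly int}) (gT : finGroupType)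
    (G : {group gT}) : Prop :=
  exists2 L : splittingFieldType rat,
    splittingFieldFor 1 (map_poly intr f : {poly L}) {:L} &
    'Gal({:L} / 1) \isog G.

Definition recip_quartic (A B : int) : {poly int} :=
  'X^4 + A *: 'X^3 + B *: 'X^2 + A *: 'X + 1.

(* In the library's notation ['D_8] is the dihedral group of order 8.          *)
Definition monogenic_D4_pair (A B : int) : Prop :=
  [/\ (A = 1 %[mod 4])%Z, (B = 1 %[mod 4])%Z,
      monogenic (recip_quartic A B)
    & galois_group_is (recip_quartic A B) 'D_(8%N)%G].

(* Main.v *)
Require Import Defs.
From HB Require Import structures.
From mathcomp Require Import all_boot all_order all_algebra all_fingroup.
From mathcomp Require Import all_solvable all_field.
From mathcomp Require Import boolp classical_sets functions cardinality.
From mathcomp Require Import ring zify.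

Set Implicit Arguments.
Unset Strict Implicit.
Unset Printing Implicit Defensive.

Import Order.TTheory GRing.Theory Num.Theory.
Local Open Scope classical_set_scope.
Local Open Scope ring_scope.

(* Write f = X^4 + A X^3 + B X^2 + A X + 1, let x be a root and y = x + 1/x, so  *)
(* that y^2 + A y + B - 2 = 0 and x^2 - y x + 1 = 0.  The trace polynomial has   *)
(* discriminant W = A^2 - 4 B + 8 (trace_disc below), and the relative           *)
(* discriminant y^2 - 4 of Q(x) / Q(y) has norm                                  *)
(* C = f(1) f(-1) = (B + 2)^2 - 4 A^2 (rel_disc_norm below).                     *)
(*                                                                               *)
(* Existence.  Take B = -1 - 2 A, so that f(1) = 1, f(-1) = 1 - 4 A and          *)
(* W = (A + 2)(A + 6).  If these are squarefree then the integers of Q(y) form   *)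
(* Z[y], and an integer u + v x of Q(x) has v (y + 2) and v^2 (y + 2) in Z[y],   *)
(* because y - 2 is a unit; as y + 2 has squarefree norm f(-1), v is in Z[y].    *)
(* Elementary sieving by odd squares (the sum of 1 / m^2 over odd m >= 3 is      *)
(* less than 1/4, and 3/4 < 1) makes 4k+3, 4k+7, 16k+3 simultaneously            *)
(* squarefree infinitely often.  Since C < 0 < W, one of the two quadratic       *)
(* factors of f over Q(y) has real roots and the other does not, so Q(x) is not  *)
(* normal; the group of order 8 is generated by two non-commuting involutions.   *)
(*                                                                               *)
(* Distinctness.  If the group is D_4 then C is not a square, which forces Q(y)  *)
(* to be the only quadratic subfield of Q(x).  For two monogenic pairs with the  *)
(* same field, the integral bases give Z[y] = Z[y'], so W = W'; and the relative *)
(* discriminants differ by the square of a unit of Z[y], so C = C'.  The values  *)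
(* W and C determine (A, B) when A = B = 1 mod 4.                                *)

(** Computations take place in the basis 1, y, x, y x of Q(x) ([quartic_independent],
    [quartic_span]), which differs from the powers of x by a unimodular integer matrix, so
    integrality of coordinates is the same in both. Existence rests on [sqfree_triples_unbounded]
    for the parameters, [quartic_integral_span] for the ring of integers and [galois_group_D8] for
    the group. For distinctness, [D8_rel_disc_norm_nonsquare] and [sqrt_in_trace_field] place the
    quadratic irrationality of one pair in the trace field of the other. Then [trace_relation] and
    [relative_disc_relation] show that W and C of one pair are integer squares times those of the
    other. By symmetry this holds both ways, so [sqr_scaling_eq] gives equality, and
    [recip_pair_of_discs] recovers the pair. *)

Lemma rat_rmorph_eq (L : fieldType) (g h : {rmorphism rat -> L}) : g =1 h.
Proof. by move=> r; rewrite [RHS]fmorph_eq_rat fmorph_eq_rat. Qed.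

(** * Conjugate roots and integrality over the rationals *)

Section IrreducibleRoots.

Variables (F L : fieldType) (I : {rmorphism F -> L}).
Variables (q : {poly F}) (x : L).
Hypothesis irr_q : irreducible_poly q.
Hypothesis qx0 : root (map_poly I q) x.

Lemma irreducible_root_dvdp (p : {poly F}) : root (map_poly I p) x -> q %| p.
Proof.
move=> px0; have [//|ndvd] := boolP (q %| p).
have : coprimep q p by rewrite irreducible_poly_coprime.
rewrite -(coprimep_map I) => /coprimep_root /(_ qx0).
by rewrite (rootP px0) eqxx.
Qed.

Lemma irreducible_small_root (p : {poly F}) :
  (size p < size q)%N -> root (map_poly I p) x -> p = 0.
Proof.
move=> sp /irreducible_root_dvdp dvd; apply/eqP; apply: contraLR sp => p0.
by rewrite -leqNgt dvdp_leq.
Qed.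

Lemma irreducible_conj (p : {poly F}) (y : L) :
  root (map_poly I q) y -> root (map_poly I p) x -> root (map_poly I p) y.
Proof.
move=> qy0 /irreducible_root_dvdp; rewrite -(dvdp_map I) => /dvdpP[r ->].
by rewrite rootM qy0 orbT.
Qed.

End IrreducibleRoots.

Section RationalScalars.

Variables (L : fieldType) (I : {rmorphism rat -> L}).

Lemma map_poly_rat_intr (p : {poly int}) :
  map_poly I (map_poly intr p) = map_poly intr p.
Proof.
by rewrite -map_poly_comp; apply: eq_map_poly => z; exact: (rmorph_int I).
Qed.

(** If p kills g(x), then p composed with g is a rational polynomial vanishing at x, hence at every
    conjugate of x. *)
Lemma integral_conj (q g : {poly rat}) (x y : L) :
  irreducible_poly q -> root (map_poly I q) x -> root (map_poly I q) y ->
  integralOver (intr : int -> L) (map_poly I g).[x] ->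
  integralOver (intr : int -> L) (map_poly I g).[y].
Proof.
move=> irr qx qy [p mp px]; exists p => //.
move: px; rewrite -!map_poly_rat_intr !rootE -!horner_comp -!map_comp_poly.
by rewrite -!rootE; apply: irreducible_conj qy.
Qed.

Lemma integral_rat_int (r : rat) :
  integralOver (intr : int -> L) (I r) -> exists z : int, r = z%:~R.
Proof.
move=> [p mp]; rewrite -map_poly_rat_intr fmorph_root => pr.
have : ratr r \in Aint.
  apply: (@root_monic_Aint (map_poly intr p)); last 2 first.
  - exact: monic_map.
  - by apply/polyOverP => i; rewrite coef_map /= intr_int.
  have := pr; rewrite -(fmorph_root (ratr : rat -> algC)) -map_poly_comp.
  by rewrite (eq_map_poly (g := intr)) // => z /=; rewrite ratr_int.
move=> /(Cint_rat_Aint (Crat_rat r)) /intrP[z hz]; exists z.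
by apply: (fmorph_inj (ratr : rat -> algC)); rewrite /= ratr_int.
Qed.

End RationalScalars.

(** * Squarefree integers *)

Definition squarefree (n : nat) := forall m, (m ^ 2 %| n)%N -> m = 1%N.

(** Dividing n and m by their gcd g leaves coprime n' and m'; then n' divides g, so n'^2 divides n
    and n' = 1. *)
Lemma squarefree_dvdn_sqr n m : squarefree n -> (n %| m ^ 2)%N -> (n %| m)%N.
Proof.
move=> sq; case: n sq => [|n] sq; first by have := sq 2%N (dvdn0 _).
set N := n.+1 in sq *; pose g := gcdn N m.
have g0 : (0 < g)%N by rewrite gcdn_gt0.
have /dvdnP[n' hn] : (g %| N)%N by rewrite dvdn_gcdl.
have /dvdnP[m' hm] : (g %| m)%N by rewrite dvdn_gcdr.
have cop : coprime n' m'.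
  rewrite /coprime -(eqn_pmul2r g0) mul1n -{1}/g muln_gcdl -hn -hm eqxx //.
rewrite {1}hn {1}hm expnMn => h.
have : (n' %| g)%N.
  have : (n' * g %| m' ^ 2 * g * g)%N by rewrite -mulnA mulnn.
  rewrite dvdn_pmul2r // Gauss_dvdr // coprimeXr //.
move=> /dvdnP[k hk]; have : (n' ^ 2 %| N)%N.
  by rewrite hn hk; apply/dvdnP; exists k; rewrite expnS expn1; lia.
by move=> /sq n1; rewrite hn hm n1 mul1n dvdn_mull.
Qed.

Lemma squarefree_prime n :
  (forall p, prime p -> ~~ (p ^ 2 %| n)%N) -> squarefree n.
Proof.
move=> h m hm; case: m hm => [|[//|m]] hm.
  have : (2 ^ 2 %| n)%N by apply: dvdn_trans hm; rewrite dvdn0.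
  by rewrite (negPf (h 2%N _)).
have /andP[pp dp] : prime (pdiv m.+2) && (pdiv m.+2 %| m.+2)%N.
  by rewrite pdiv_prime // pdiv_dvd.
have : (pdiv m.+2 ^ 2 %| n)%N by apply: dvdn_trans hm; rewrite dvdn_exp2r.
by rewrite (negPf (h _ _)).
Qed.

Lemma squarefreeM m n :
  coprime m n -> squarefree m -> squarefree n -> squarefree (m * n).
Proof.
move=> cop sm sn; apply: squarefree_prime => p pp; apply/negP => h.
have p1 : p <> 1%N by move=> p1; rewrite p1 in pp.
have [pm|pm] := boolP (p %| m)%N.
  have cpn : coprime (p ^ 2) n by rewrite coprimeXl // (coprime_dvdl pm).
  by move: h; rewrite Gauss_dvdl // => /sm.
have cpm : coprime (p ^ 2) m by rewrite coprimeXl // prime_coprime.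
by move: h; rewrite Gauss_dvdr // => /sn.
Qed.

(** With b in lowest terms, the square of its denominator divides W. *)
Lemma squarefree_sqr_rat (W z : int) (b : rat) : squarefree `|W| ->
  b ^+ 2 * W%:~R = z%:~R -> exists n : int, b = n%:~R.
Proof.
move=> sW; have d0 : (denq b)%:~R != 0 :> rat by rewrite intr_eq0 denq_eq0.
rewrite -[b]divq_num_den expr_div_n => h.
have {}h : (numq b ^+ 2 * W = z * denq b ^+ 2)%R.
  apply: (@intr_inj rat); rewrite [LHS]rmorphM [RHS]rmorphM !rmorphXn/= -h.
  by field.
have dv : (`|denq b| ^ 2 %| `|numq b| ^ 2 * `|W|)%N.
  by rewrite -!abszX -!abszM h abszM dvdn_mull.
move: dv; rewrite Gauss_dvdr; last first.
  by rewrite coprimeXl // coprimeXr // coprime_sym coprime_num_den.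
move=> /sW d1; exists (numq b).
have -> : denq b = 1 by rewrite -(gtz0_abs (denq_gt0 b)) d1.
by rewrite divr1.
Qed.

(** * The reciprocal quartic and the basis 1, y, x, y x *)

Definition trace_disc (A B : int) : int := A ^+ 2 - 4 * B + 8.
Definition rel_disc_norm (A B : int) : int := (B + 2) ^+ 2 - 4 * A ^+ 2.

Lemma map_recip_quartic (R : comNzRingType) (A B : int) :
  map_poly intr (recip_quartic A B) =
  'X^4 + A%:~R *: 'X^3 + B%:~R *: 'X^2 + A%:~R *: 'X + 1 :> {poly R}.
Proof.
rewrite /recip_quartic !rmorphD /= !map_polyZ !map_polyXn map_polyX.
by rewrite rmorph1.
Qed.

Lemma horner_recip_quartic (R : comNzRingType) (A B : int) (x : R) :
  (map_poly intr (recip_quartic A B)).[x] =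
  x ^+ 4 + A%:~R * x ^+ 3 + B%:~R * x ^+ 2 + A%:~R * x + 1.
Proof. by rewrite map_recip_quartic !hornerE. Qed.

Lemma recip_quarticE (A B : int) :
  recip_quartic A B = Poly [:: 1; A; B; A; 1].
Proof.
by rewrite /recip_quartic /= !cons_poly_def -!mul_polyC; ring.
Qed.

Lemma size_recip_quartic (A B : int) : size (recip_quartic A B) = 5.
Proof. by rewrite recip_quarticE (@PolyK _ 0) //= oner_eq0. Qed.

Lemma recip_quartic_monic (A B : int) : recip_quartic A B \is monic.
Proof.
rewrite monicE /lead_coef size_recip_quartic recip_quarticE.
by rewrite (@PolyK _ 0) //= oner_eq0.
Qed.

Lemma size_recip_quartic_rat (A B : int) :
  size (map_poly intr (recip_quartic A B) : {poly rat}) = 5.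
Proof.
by rewrite size_map_inj_poly ?size_recip_quartic ?rmorph0 //; apply: intr_inj.
Qed.

Lemma horner_map_Poly (R S : comNzRingType) (g : {rmorphism R -> S}) s (x : S) :
  (map_poly g (Poly s)).[x] = \sum_(i < size s) g s`_i * x ^+ i.
Proof.
rewrite map_Poly_id0 ?rmorph0 // horner_Poly.
elim: s => [|a s ih]; first by rewrite /= big_ord0.
rewrite /= big_ord_recl /= expr0 mulr1 ih addrC mulr_suml; congr (_ + _).
by apply: eq_bigr => i _; rewrite /bump /= add1n exprSr mulrA.
Qed.

Section Quartic.

Variables (L : fieldExtType rat) (I : {rmorphism rat -> L}).
Variables (A B : int) (x : L).
Hypothesis irr : irreducible_poly (map_poly intr (recip_quartic A B) : {poly rat}).
Hypothesis rx : root (map_poly intr (recip_quartic A B)) x.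

Let f : {poly rat} := map_poly intr (recip_quartic A B).
Let y := x + x^-1.

Lemma quartic_eq : x ^+ 4 + A%:~R * x ^+ 3 + B%:~R * x ^+ 2 + A%:~R * x + 1 = 0.
Proof. by rewrite -horner_recip_quartic; apply/rootP. Qed.

Lemma quartic_root_neq0 : x != 0.
Proof.
apply/eqP => x0; have := quartic_eq; rewrite x0 !expr0n /= !mulr0 !add0r.
by move/eqP; rewrite oner_eq0.
Qed.

Lemma root_map_quartic : root (map_poly I f) x.
Proof. by rewrite /f map_poly_rat_intr. Qed.

Lemma quartic_rootV : root (map_poly intr (recip_quartic A B)) x^-1.
Proof.
rewrite rootE horner_recip_quartic; apply/eqP.
have x0 := quartic_root_neq0.
apply: (mulfI (expf_neq0 4 x0)); rewrite mulr0 -[RHS]quartic_eq.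
by field.
Qed.

Lemma sqr_root : x ^+ 2 = y * x - 1.
Proof. by rewrite /y; have := quartic_root_neq0; move=> h; field. Qed.

Lemma trace_eq : y ^+ 2 = - A%:~R * y - (B%:~R - 2).
Proof.
have x0 := quartic_root_neq0; apply: (mulfI (expf_neq0 2 x0)).
apply/eqP; rewrite -subr_eq0 -quartic_eq /y; apply/eqP.
by field.
Qed.

(** Dividing f(x) = 0 by x expresses 1/x, hence y, through powers of x with integer coefficients. *)
Lemma trace_cubic : y = - x ^+ 3 - A%:~R * x ^+ 2 - (B%:~R - 1) * x - A%:~R.
Proof.
have x0 := quartic_root_neq0; apply: (mulfI x0).
apply/eqP; rewrite -subr_eq0 -quartic_eq /y; apply/eqP.
by field.
Qed.

Lemma quartic_independent (a b c d : rat) :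
  I a + I b * y + I c * x + I d * (y * x) = 0 -> [/\ a = 0, b = 0, c = 0 & d = 0].
Proof.
(* The combination written in powers of x, by [trace_cubic] and y x = x^2 + 1. *)
pose p := Poly [:: a - A%:~R * b + d; c - (B%:~R - 1) * b; d - A%:~R * b; - b].
move=> h; have : p = 0.
  have yx : y * x = x ^+ 2 + 1 by rewrite sqr_root; ring.
  rewrite yx trace_cubic in h.
  apply: (irreducible_small_root irr root_map_quartic).
    by rewrite size_recip_quartic_rat (leq_ltn_trans (size_Poly _)).
  rewrite rootE horner_map_Poly -[X in _ == X]h; apply/eqP.
  by rewrite !big_ord_recl big_ord0 /= /bump /= !add1n; ring.
move=> p0; have cf i : p`_i = 0 by rewrite p0 coef0.
have := (cf 0%N, cf 1%N, cf 2%N, cf 3%N).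
rewrite /p !coef_Poly /= => -[[[e0 e1] e2] e3].
have b0 : b = 0 by rewrite -[b]opprK e3 oppr0.
move: e0 e1 e2; rewrite b0 !mulr0 !subr0 => e0 e1 e2.
by move: e0; rewrite e2 addr0.
Qed.

Lemma quartic_span (z : L) : z \in <<1; x>>%VS ->
  exists a b c d : rat, z = I a + I b * y + I c * x + I d * (y * x).
Proof.
move=> /Fadjoin_polyP[p /polyOver1P[q ->] ->].
(* The library maps coefficients by [in_alg L]; a ring morphism out of the rationals is unique, so
   [I] may replace it. *)
rewrite (eq_map_poly (rat_rmorph_eq _ I)).
have f0 : f != 0 by rewrite -size_poly_eq0 size_recip_quartic_rat.
have := ltn_modp q f; rewrite f0 size_recip_quartic_rat ltnS => sr.
have -> : (map_poly I q).[x] = (map_poly I (q %% f)).[x].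
  rewrite {1}(divp_eq q f) rmorphD rmorphM /= hornerD hornerM.
  by rewrite (rootP root_map_quartic) mulr0 add0r.
set r := q %% f in sr *.
have -> : r = Poly [:: r`_0; r`_1; r`_2; r`_3].
  apply/polyP => i; rewrite coef_Poly; case: i => [|[|[|[|i]]]] //=.
  by rewrite !nth_nil nth_default // (leq_trans sr).
(* These witnesses invert the change of basis used in [quartic_independent]. *)
exists (r`_0 + A%:~R * (- r`_3) - (r`_2 + A%:~R * (- r`_3))), (- r`_3).
exists (r`_1 + (B%:~R - 1) * (- r`_3)), (r`_2 + A%:~R * (- r`_3)).
have -> : y * x = x ^+ 2 + 1 by rewrite sqr_root; ring.
rewrite trace_cubic horner_map_Poly.
by rewrite !big_ord_recl big_ord0 /= /bump /= !add1n; ring.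
Qed.

Lemma trace_in : y \in <<1; x>>%VS.
Proof. by rewrite /y rpredD ?memv_adjoin // rpredV memv_adjoin. Qed.

End Quartic.

(** * The quadratic subfield Q(y) *)

Section TraceField.

Variables (L : fieldExtType rat) (I : {rmorphism rat -> L}).
Variables (A B : int) (x : L).
Hypothesis irr : irreducible_poly (map_poly intr (recip_quartic A B) : {poly rat}).
Hypothesis rx : root (map_poly intr (recip_quartic A B)) x.

Let y := x + x^-1.
Let y' := - A%:~R - y.

(** Membership in Q(z) for a quadratic z, in explicit coordinates that the independence lemmas can
    compare. *)
Definition in_trace_field (z t : L) := exists a b : rat, t = I a + I b * z.

Lemma trace_field_rat (r : rat) : in_trace_field y (I r).
Proof. by exists r, 0; rewrite rmorph0 mul0r addr0. Qed.

Lemma trace_field_gen : in_trace_field y y.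
Proof. by exists 0, 1; rewrite rmorph0 rmorph1 mul1r add0r. Qed.

Lemma trace_fieldD s t :
  in_trace_field y s -> in_trace_field y t -> in_trace_field y (s + t).
Proof. by move=> [a [b ->]] [c [d ->]]; exists (a + c), (b + d); ring. Qed.

Lemma trace_fieldM s t :
  in_trace_field y s -> in_trace_field y t -> in_trace_field y (s * t).
Proof.
move=> [a [b ->]] [c [d ->]].
exists (a * c - b * d * (B%:~R - 2)), (a * d + b * c - A%:~R * b * d).
transitivity (I (a * c) + I (a * d + b * c) * y + I (b * d) * y ^+ 2); first by ring.
by rewrite /y (trace_eq rx) -/y; ring.
Qed.

Lemma trace_fieldN s : in_trace_field y s -> in_trace_field y (- s).
Proof. by move=> [a [b ->]]; exists (- a), (- b); ring. Qed.

Lemma trace_field_int (z : int) : in_trace_field y z%:~R.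
Proof. by rewrite -(rmorph_int I); apply: trace_field_rat. Qed.

Lemma trace_field_independent u v :
  in_trace_field y u -> in_trace_field y v -> u + v * x = 0 -> u = 0 /\ v = 0.
Proof.
move=> [a [b ->]] [c [d ->]] h.
have [|-> -> -> ->] := @quartic_independent L I A B x irr rx a b c d.
  by rewrite -[RHS]h -/y; ring.
by rewrite !rmorph0 mul0r addr0.
Qed.

Lemma trace_independent a b : I a + I b * y = 0 -> a = 0 /\ b = 0.
Proof.
move=> h; have [//|-> -> _ _ //] := @quartic_independent L I A B x irr rx a b 0 0.
by rewrite -/y h !rmorph0 !mul0r !addr0.
Qed.

Lemma root_not_in_trace_field : ~ in_trace_field y x.
Proof.
move=> [a [b h]].
have [|_ _ c0 _] := @quartic_independent L I A B x irr rx a b (-1) 0.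
  by rewrite -/y -h; ring.
by have := oner_neq0 rat; rewrite -[1]opprK c0 oppr0 eqxx.
Qed.

Definition trace_poly : {poly rat} := Poly [:: B%:~R - 2; A%:~R; 1].

Lemma root_trace_poly (g : {rmorphism rat -> L}) (z : L) :
  root (map_poly g trace_poly) z = (z ^+ 2 + A%:~R * z + (B%:~R - 2) == 0).
Proof.
rewrite rootE horner_map_Poly !big_ord_recl big_ord0 /= /bump /= !add1n.
by congr (_ == _); ring.
Qed.

Lemma trace_poly_root : root (map_poly I trace_poly) y.
Proof. by rewrite root_trace_poly /y (trace_eq rx); apply/eqP; ring. Qed.

Lemma trace_poly_root_conj : root (map_poly I trace_poly) y'.
Proof.
have := trace_poly_root; rewrite !root_trace_poly => /eqP <-.
by apply/eqP; rewrite /y'; ring.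
Qed.

(** A rational root r would make y equal to r or to -A - r, against the independence of 1 and y. *)
Lemma trace_poly_irr : irreducible_poly trace_poly.
Proof.
apply: cubic_irreducible.
  by rewrite (@PolyK _ 0) //= oner_eq0.
move=> r; apply/negP; rewrite -(fmorph_root I) root_trace_poly => /eqP h.
have : (y - I r) * (y + A%:~R + I r) = 0.
  have := trace_poly_root; rewrite root_trace_poly => /eqP h'.
  by rewrite -[RHS]subr0 -{2}h -h'; ring.
move=> /eqP; rewrite mulf_eq0 => /orP[] /eqP e.
  have [|_ /eqP] := @trace_independent (- r) 1; last by rewrite oner_eq0.
  by rewrite -[RHS]e; ring.
have [|_ /eqP] := @trace_independent (r + A%:~R) 1; last by rewrite oner_eq0.
by rewrite -[RHS]e; ring.
Qed.

Lemma trace_conj_sum : y + y' = - A%:~R.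
Proof. by rewrite /y'; ring. Qed.

Lemma trace_conj_prod : y * y' = B%:~R - 2.
Proof.
rewrite /y'; transitivity (- y ^+ 2 - A%:~R * y); first by ring.
by rewrite /y (trace_eq rx); ring.
Qed.

(** Stands in for the nontrivial automorphism of Q(y): a rational relation satisfied by y is
    satisfied by y'. *)
Lemma trace_conj_horner (p : {poly rat}) :
  (map_poly I p).[y] = 0 -> (map_poly I p).[y'] = 0.
Proof.
move=> /rootP h; apply/rootP.
apply: (irreducible_conj trace_poly_irr trace_poly_root) h.
exact: trace_poly_root_conj.
Qed.

Lemma rel_disc_normE : (y ^+ 2 - 4) * (y' ^+ 2 - 4) = (rel_disc_norm A B)%:~R.
Proof.
transitivity ((y * y') ^+ 2 - 4 * ((y + y') ^+ 2 - 2 * (y * y')) + 16); first by ring.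
by rewrite trace_conj_sum trace_conj_prod /rel_disc_norm; ring.
Qed.

(** The norm of a + b y from Q(y) to Q. *)
Definition trace_norm (a b : rat) : rat :=
  a ^+ 2 - A%:~R * a * b + (B%:~R - 2) * b ^+ 2.

Lemma trace_normE (a b : rat) :
  (I a + I b * y) * (I a + I b * y') = I (trace_norm a b).
Proof.
transitivity (I a ^+ 2 + I a * I b * (y + y') + I b ^+ 2 * (y * y')); first by ring.
by rewrite trace_conj_sum trace_conj_prod /trace_norm; ring.
Qed.

Lemma trace_norm_eq0 (a b : rat) : trace_norm a b = 0 -> a = 0 /\ b = 0.
Proof.
move=> h; have := trace_normE a b; rewrite h rmorph0 => /eqP.
rewrite mulf_eq0 => /orP[] /eqP; first exact: trace_independent.
have -> : I a + I b * y' = I (a - A%:~R * b) + I (- b) * y by rewrite /y'; ring.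
move=> /trace_independent[e /eqP]; rewrite oppr_eq0 => /eqP b0.
by rewrite b0 in e *; rewrite -e mulr0 subr0.
Qed.

Lemma rel_disc_norm_sqr (p : {poly rat}) (c d : rat) :
  (I c + I d * y) ^+ 2 * (y ^+ 2 - 4) = (map_poly I p).[y] ->
  I (trace_norm c d) ^+ 2 * (rel_disc_norm A B)%:~R = (map_poly I p).[y] * (map_poly I p).[y'].
Proof.
pose q := Poly [:: c; d] ^+ 2 * Poly [:: - 4%:R; 0; 1] - p.
have qE z : (map_poly I q).[z] =
    (I c + I d * z) ^+ 2 * (z ^+ 2 - 4) - (map_poly I p).[z].
  rewrite /q rmorphB rmorphM rmorphXn hornerD hornerN hornerM horner_exp.
  rewrite !horner_map_Poly !big_ord_recl !big_ord0 /= /bump /= !add1n.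
  by ring.
move=> h; have qy : (map_poly I q).[y] = 0 by rewrite qE h subrr.
have /eqP := trace_conj_horner qy; rewrite qE subr_eq0 => /eqP <-.
by rewrite -h -trace_normE -rel_disc_normE; ring.
Qed.

Lemma two_neq0 : 2 != 0 :> L.
Proof. by rewrite -(rmorph_nat I) fmorph_eq0. Qed.

(** Write s = u + v x. The coefficient of x in s^2 gives v (2 u + v y) = 0. If v is nonzero, the
    constant coefficient becomes v^2 (y^2 - 4) = 4 w, and taking norms makes C a rational square. *)
Lemma sqrt_in_trace_field (s : L) (w : rat) :
  (forall r : rat, r ^+ 2 <> (rel_disc_norm A B)%:~R) ->
  s \in <<1; x>>%VS -> s ^+ 2 = I w -> in_trace_field y s.
Proof.
move=> nsq /(quartic_span I rx); rewrite -/y => -[a [b [c [d sE]]]] sw.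
pose u := I a + I b * y; pose v := I c + I d * y.
have Fu : in_trace_field y u by exists a, b.
have Fv : in_trace_field y v by exists c, d.
have {}sE : s = u + v * x by rewrite sE /u /v; ring.
have [|||] := @trace_field_independent
    (u * u + - (v * v) + - I w) (v * (u + u + v * y)).
- apply: trace_fieldD; last exact/trace_fieldN/trace_field_rat.
  by apply: trace_fieldD; [|apply: trace_fieldN]; apply: trace_fieldM.
- apply: trace_fieldM => //; apply: trace_fieldD; first exact: trace_fieldD.
  by apply: trace_fieldM => //; apply: trace_field_gen.
- rewrite -sw sE; have := sqr_root rx; rewrite -/y => x2.
  transitivity (- v ^+ 2 * (x ^+ 2 - (y * x - 1))); first by ring.
  by rewrite x2; ring.
move=> e0 /eqP; rewrite mulf_eq0 => /orP[/eqP v0|/eqP e1].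
  by rewrite sE v0 mul0r addr0.
have [v0|v0] := eqVneq v 0; first by rewrite sE v0 mul0r addr0.
have vd : v ^+ 2 * (y ^+ 2 - 4) = (map_poly I (4 * w)%:P).[y].
  rewrite map_polyC hornerC.
  have uE : u * 2 = - (v * y) by apply/eqP; rewrite -subr_eq0 -e1; apply/eqP; ring.
  have -> : v ^+ 2 * (y ^+ 2 - 4) = (u * 2) ^+ 2 - 4 * v ^+ 2 by rewrite uE; ring.
  by apply/eqP; rewrite -subr_eq0 -[X in _ == X](mulr0 4) -e0 /=; apply/eqP; ring.
have := rel_disc_norm_sqr vd.
rewrite !map_polyC !hornerC -(rmorph_int I) -rmorphXn -!rmorphM => /fmorph_inj e.
have n0 : trace_norm c d != 0.
  by apply: contraNneq v0 => /trace_norm_eq0[c0 d0]; rewrite /v c0 d0 !rmorph0 mul0r addr0.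
case: (nsq (4 * w / trace_norm c d)).
by apply: (mulfI (expf_neq0 2 n0)); rewrite e; field.
Qed.

End TraceField.

(** * Consequences of the Galois group and of monogenicity *)

Lemma galois_rat (L : splittingFieldType rat) (K : {subfield L}) :
  galois K {:L}.
Proof.
rewrite /galois subvf normalFieldf andbT; apply/separableP => z _.
by apply: pcharf0_separable => p; rewrite pchar_lalg pchar_num.
Qed.

Lemma dim_adjoin_le4 (L : fieldExtType rat) (A B : int) (x : L) :
  root (map_poly intr (recip_quartic A B)) x -> (\dim <<1; x>> <= 4)%N.
Proof.
move=> rx; rewrite dim_Fadjoin dimv1 muln1 -ltnS -size_minPoly.
rewrite -(map_poly_rat_intr (in_alg L)) in rx.
apply: leq_trans (_ : (size
  (map_poly (in_alg L) (map_poly intr (recip_quartic A B)) : {poly L}) <= 5)%N).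
  apply: dvdp_leq; last by apply: minPoly_dvdp => //; apply/polyOver1P; eexists.
  by rewrite -size_poly_eq0 size_map_poly size_recip_quartic_rat.
by rewrite size_map_poly size_recip_quartic_rat.
Qed.

(** For roots x, z with traces y, y', the square of (z - 1/z)(x - 1/x) is C. If C = r^2, this
    product is r or -r, so z - 1/z and then z lie in Q(x). The splitting field would have degree at
    most 4, while the group has order 8. *)
Lemma D8_rel_disc_norm_nonsquare (A B : int) :
  irreducible_poly (map_poly intr (recip_quartic A B) : {poly rat}) ->
  galois_group_is (recip_quartic A B) 'D_(8%N)%G ->
  forall r : rat, r ^+ 2 <> (rel_disc_norm A B)%:~R.
Proof.
move=> irr [L [rs fE genL] isoD] r rC.
have card8 : #|'Gal({:L} / 1)%g| = 8 by rewrite (card_isog isoD) (card_2dihedral (n := 3)).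
have rootE z : root (map_poly intr (recip_quartic A B)) z = (z \in rs).
  by rewrite (eqp_root fE) root_prod_XsubC.
have [x rx] : exists x, root (map_poly intr (recip_quartic A B) : {poly L}) x.
  case: rs fE {genL rootE} => [|x rs] fE; last first.
    by exists x; rewrite (eqp_root fE) root_prod_XsubC mem_head.
  have := eqp_size fE; rewrite big_nil size_poly1 -(map_poly_rat_intr (in_alg L)).
  by rewrite size_map_poly size_recip_quartic_rat.
suff : ({:L} <= <<1; x>>)%VS.
  move=> /dimvS /leq_trans /(_ (dim_adjoin_le4 rx)).
  by have := galois_dim (galois_rat 1%AS : galois 1 {:L}); rewrite card8 dimv1 divn1 => ->.
rewrite -genL; apply/Fadjoin_seqP; split; first exact: subv_adjoin.
move=> z; rewrite -rootE => rz.
have x0 := quartic_root_neq0 rx; have z0 := quartic_root_neq0 rz.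
have xK : x \in <<1; x>>%VS by apply: memv_adjoin.
have two0 : 2 != 0 :> L := two_neq0 (in_alg L).
pose y := x + x^-1; pose t := z + z^-1.
have : (t - y) * (t + A%:~R + y) = 0.
  transitivity ((t ^+ 2 + A%:~R * t) - (y ^+ 2 + A%:~R * y)); first by ring.
  by rewrite /t /y (trace_eq rx) (trace_eq rz); ring.
move=> /eqP; rewrite mulf_eq0 => /orP[] /eqP e.
  have /eqP : (z - x) * (z - x^-1) = 0.
    apply: (mulIf (invr_neq0 z0)); rewrite mul0r -e /t /y; field.
    by rewrite z0 x0.
  rewrite mulf_eq0 !subr_eq0 => /orP[] /eqP ->; first exact: memv_adjoin.
  by rewrite rpredV.
have tE : t = - A%:~R - y by apply/eqP; rewrite -subr_eq0 -e; apply/eqP; ring.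
(* Otherwise x = y / 2 would lie in Q(y). *)
have xx0 : x - x^-1 != 0.
  apply/eqP => h; case: (@root_not_in_trace_field L (in_alg L) A B x irr rx).
  exists 0, 2^-1; rewrite rmorph0 add0r fmorphV (rmorph_nat (in_alg L)).
  have -> : 2^-1 * (x + x^-1) = x - 2^-1 * (x - x^-1) by field; rewrite two0 x0.
  by rewrite h mulr0 subr0.
have : ((z - z^-1) * (x - x^-1)) ^+ 2 = (in_alg L r) ^+ 2.
  rewrite -rmorphXn rC [RHS](rmorph_int (in_alg L)).
  rewrite -(rel_disc_normE rx) -/y -tE /t /y; field.
  by rewrite z0 x0.
move=> /eqP; rewrite eqf_sqr => h.
have zz : z - z^-1 \in <<1; x>>%VS.
  have rK : in_alg L r \in <<1; x>>%VS by rewrite /= rpredZ // rpred1.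
  have xxK : x - x^-1 \in <<1; x>>%VS by rewrite rpredB // rpredV.
  rewrite -[z - z^-1](mulfK xx0) rpredM // ?rpredV //.
  by case/orP: h => /eqP ->; rewrite ?rpredN.
have tK : t \in <<1; x>>%VS.
  by rewrite tE rpredB // ?rpredN ?rpred_int // rpredD // rpredV.
have -> : z = (t + (z - z^-1)) / 2 by rewrite /t; field; rewrite two0 z0.
by apply: rpredM; [apply: rpredD | rewrite rpredV rpred_nat].
Qed.

Lemma quartic_int_span (L : fieldExtType rat) (A B : int) (x z : L) :
  monogenic (recip_quartic A B) ->
  root (map_poly intr (recip_quartic A B)) x ->
  ring_of_integers <<1; x>>%VS z ->
  exists a b c d : int, z = a%:~R + b%:~R * (x + x^-1) + c%:~R * x
                             + d%:~R * ((x + x^-1) * x).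
Proof.
move=> [_ _ mono] rx Oz; have [_ _ /(_ _ Oz)] := mono _ _ rx.
rewrite size_recip_quartic => -[c ->].
under eq_bigr do rewrite -mulrzr.
rewrite !big_ord_recl big_ord0 /= /bump /= !add1n.
set c0 := c _; set c1 := c _; set c2 := c _; set c3 := c _.
have x0 := quartic_root_neq0 rx.
exists (c0 + A * (- c3) - (c2 + A * (- c3))), (- c3).
exists (c1 + (B - 1) * (- c3)), (c2 + A * (- c3)).
have -> : (x + x^-1) * x = x ^+ 2 + 1 by field.
by rewrite (trace_cubic rx); ring.
Qed.

Lemma integral_root (L : fieldExtType rat) (A B : int) (x : L) :
  root (map_poly intr (recip_quartic A B)) x ->
  integralOver (intr : int -> L) x.
Proof. by move=> rx; exists (recip_quartic A B) => //; apply: recip_quartic_monic. Qed.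

Lemma integral_trace (L : fieldExtType rat) (A B : int) (x : L) :
  root (map_poly intr (recip_quartic A B)) x ->
  integralOver (intr : int -> L) (x + x^-1).
Proof.
move=> rx; apply: (@integral_add _ _ (intr : {rmorphism int -> L})).
  exact: integral_root rx.
exact: integral_root (quartic_rootV rx).
Qed.

(** * Simultaneous squarefree values of linear forms *)

(** As a is invertible mod M, the solutions lie in a single class mod M, so k is determined by its
    quotient by M. *)
Lemma count_dvdn_affine (a b M N : nat) : (0 < M)%N -> coprime a M ->
  (\sum_(k < N) (M %| a * k + b) <= (N %/ M).+1)%N.
Proof.
move=> M0 cop; rewrite -big_mkcond /= sum1dep_card.
pose f (k : 'I_N) : 'I_(N %/ M).+1 := inord (k %/ M).
have fE k : f k = (k %/ M)%N :> nat.
  by rewrite inordK // ltnS leq_div2r // ltnW.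
rewrite -[X in (_ <= X)%N]card_ord -(@card_in_imset _ _ f); first exact: max_card.
move=> k l; rewrite !inE => hk hl /(congr1 val) /=; rewrite !fE => e.
apply/val_inj => /=; rewrite (divn_eq k M) (divn_eq l M) e; congr (_ + _)%N.
wlog le_lk : k l hk hl e / (l <= k)%N.
  by move=> w; case: (leqP l k) => [|/ltnW] le; [|symmetry]; apply: w.
apply/eqP; rewrite eqn_mod_dvd // -(Gauss_dvdr _ (_ : coprime M a)) 1?coprime_sym //.
by rewrite mulnBr -(subnDr b) dvdn_sub.
Qed.

(* [1 / (2 j + 1)^2 < (1 / j - 1 / j.+1) / 4], and the right side telescopes. *)
Lemma sum_div_odd_sqr (N J : nat) :
  (4 * \sum_(1 <= j < J) N %/ (2 * j + 1) ^ 2 <= N)%N.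
Proof.
suff h J' : (4 * J'.+1 * \sum_(1 <= j < J'.+1) N %/ (2 * j + 1) ^ 2 <= N * J')%N.
  case: J => [|J]; first by rewrite big_geq.
  have := h J; set S := (\sum_(_ <= _ < _) _)%N; nia.
elim: J' => [|J' ih]; first by rewrite big_geq ?muln0.
rewrite big_nat_recr //=.
have := leq_trunc_div N ((2 * J'.+1 + 1) ^ 2).
move: ih; set S := (\sum_(_ <= _ < _) _)%N; set q := (N %/ _)%N.
rewrite expnS expn1 => ih hq.
rewrite -(leq_pmul2l (_ : 0 < J'.+1)%N) //.
have : (J'.+2 * (4 * J'.+1 * S) <= J'.+2 * (N * J'))%N by rewrite leq_mul2l ih orbT.
nia.
Qed.

Lemma not_squarefree_odd (n T : nat) : odd n -> (n < (4 * T) ^ 2)%N ->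
  ~ squarefree n ->
  exists2 j, (1 <= j < 2 * T)%N & ((2 * j + 1) ^ 2 %| n)%N.
Proof.
move=> on nT /existsNP[m] /not_implyP[mn /eqP m1].
have n0 : (0 < n)%N by rewrite odd_gt0.
have om : odd m by have := dvdn_odd mn on; rewrite oddX.
have mE : m = (2 * m./2 + 1)%N by rewrite -[LHS]odd_double_half om; lia.
exists m./2; last by rewrite -mE.
have : (m ^ 2 < (4 * T) ^ 2)%N := leq_ltn_trans (dvdn_leq n0 mn) nT.
by rewrite ltn_exp2r //; lia.
Qed.

Lemma affine_lt_sqr (c d k T : nat) :
  (c <= 16)%N -> (d <= 7)%N -> (k < T ^ 2)%N -> (c * k + d < (4 * T) ^ 2)%N.
Proof.
move=> c16 d7; rewrite expnMn; have : (c * k <= 16 * k)%N by rewrite leq_mul.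
by rewrite (_ : 4 ^ 2 = 16)%N //; move: (T ^ 2)%N => T2; lia.
Qed.

Lemma sqfree_triples_unbounded (n : nat) : exists k : nat,
  [/\ (n <= k)%N, squarefree (4 * k + 3), squarefree (4 * k + 7)
    & squarefree (16 * k + 3)].
Proof.
apply: contrapT => none.
(* For k < T^2 the three values are below (4 T)^2, so only j < 2 T matters. If every k from n on
   failed, then T^2 <= n + 3 T^2 / 4 + 6 T, which this T contradicts. *)
pose T := (4 * (n + 7))%N; pose N := (T ^ 2)%N.
pose bad (j k : nat) := (((2 * j + 1) ^ 2 %| 4 * k + 3)%N
   + ((2 * j + 1) ^ 2 %| 4 * k + 7)%N + ((2 * j + 1) ^ 2 %| 16 * k + 3)%N)%N.
have cover (k : 'I_N) : (1 <= (k < n)%N + \sum_(1 <= j < 2 * T) bad j k)%N.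
  case: (ltnP k n) => //= nk; rewrite ?add0n.
  have kN := ltn_ord k; rewrite /N in kN.
  have sq c d : (c <= 16)%N -> (d <= 7)%N -> odd (c * k + d) ->
      (forall j, (1 <= j < 2 * T)%N -> ~~ ((2 * j + 1) ^ 2 %| c * k + d)%N) ->
      squarefree (c * k + d).
    move=> c16 d7 o h; apply: contrapT => /(not_squarefree_odd o).
    by move=> /(_ _ (affine_lt_sqr c16 d7 kN))[j /h/negP].
  have [j jT bj] : exists2 j, (1 <= j < 2 * T)%N & (0 < bad j k)%N.
    apply: contrapT => nobad; apply: none; exists k.
    have nb j : (1 <= j < 2 * T)%N -> bad j k = 0%N.
      by move=> jT; case: (posnP (bad j k)) => // bj; case: nobad; exists j.
    split=> //; [apply: (@sq 4 3) | apply: (@sq 4 7) | apply: (@sq 16 3)] => //;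
      try (by lia); by move=> j /nb; rewrite /bad; do 3?case: (_ %| _)%N.
  by rewrite (bigD1_seq j) ?iota_uniq ?mem_index_iota //= (leq_trans bj) ?leq_addr.
have : (N <= \sum_(k < N) ((k < n)%N + \sum_(1 <= j < 2 * T) bad j k))%N.
  rewrite -[X in (X <= _)%N]card_ord -sum1_card; exact: leq_sum.
rewrite big_split /= exchange_big /=.
have hn : (\sum_(k < N) (k < n) <= n)%N.
  suff h M : (\sum_(k < M) (k < n) <= minn M n)%N by have := h N; lia.
  elim: M => [|M ih]; first by rewrite big_ord0.
  rewrite big_ord_recr /=; move: ih; set s := (\sum_(k < M) _)%N.
  by case: (ltnP M n) => Mn /=; lia.
have hb j : (\sum_(k < N) bad j k <= 3 * (N %/ (2 * j + 1) ^ 2) + 3)%N.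
  rewrite /bad !big_split /=.
  have cop c : coprime 2 (2 * j + 1) -> coprime (2 ^ c) ((2 * j + 1) ^ 2).
    by move=> h; rewrite coprimeXl // coprimeXr.
  have c2 : coprime 2 (2 * j + 1) by rewrite coprime2n; lia.
  have M0 : (0 < (2 * j + 1) ^ 2)%N by rewrite expn_gt0 addn1.
  have h1 := @count_dvdn_affine 4 3 _ N M0 (cop 2 c2).
  have h2 := @count_dvdn_affine 4 7 _ N M0 (cop 2 c2).
  have h3 := @count_dvdn_affine 16 3 _ N M0 (cop 4 c2).
  apply: leq_trans (leq_add (leq_add h1 h2) h3) _.
  by move: (N %/ _)%N => q; lia.
have hs : (\sum_(1 <= j < 2 * T) \sum_(k < N) bad j k
    <= 3 * \sum_(1 <= j < 2 * T) (N %/ (2 * j + 1) ^ 2) + 3 * (2 * T))%N.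
  apply: (@leq_trans (\sum_(1 <= j < 2 * T) (3 * (N %/ (2 * j + 1) ^ 2) + 3))%N).
    by apply: leq_sum => j _; apply: hb.
  rewrite big_split /= -big_distrr /= leq_add2l sum_nat_const_nat; lia.
have := sum_div_odd_sqr N (2 * T).
move: hs hn; set S1 := (\sum_(1 <= j < _) \sum_(k < _) _)%N.
set S2 := (\sum_(1 <= j < _) _)%N; set S3 := (\sum_(k < N) _)%N.
rewrite /N /T expnS expn1 => h1 h2 h3 h4; nia.
Qed.

(** * Irreducibility *)

Lemma F2P (a : 'F_2) : a = 0 \/ a = 1.
Proof. by case: a => [[|[|//]] i]; [left | right]; apply/val_inj. Qed.

Lemma F2_mul_eq1 (a b : 'F_2) : a * b = 1 -> a = 1 /\ b = 1.
Proof.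
by case: (F2P a) => ->; case: (F2P b) => -> // /eqP; rewrite ?mulr0 ?mul0r.
Qed.

Lemma F2_intr (a : int) : (a = 1 %[mod 4])%Z -> a%:~R = 1 :> 'F_2.
Proof.
move=> h; have -> : a = 2 * (a %/ 2)%Z + 1 by lia.
rewrite rmorphD rmorphM /= -[RHS]add0r; congr (_ + _).
have -> : 2%:~R = 0 :> 'F_2 by apply/eqP.
by rewrite mul0r.
Qed.

(* Modulo 2 the quartic is [X^4 + X^3 + X^2 + X + 1], irreducible over F_2. *)
Section ReductionModTwo.

Variables (A B : int) (p r : {poly int}).
Hypothesis oddA : (A = 1 %[mod 4])%Z.
Hypothesis oddB : (B = 1 %[mod 4])%Z.
Hypothesis fE : recip_quartic A B = p * r.

Let m2 (q : {poly int}) : {poly 'F_2} := map_poly intr q.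

Lemma factors_F2E : m2 p * m2 r = Poly [:: 1; 1; 1; 1; 1].
Proof.
rewrite -rmorphM /= -fE recip_quarticE map_Poly_id0 ?rmorph0 //=.
by rewrite !F2_intr.
Qed.

Lemma lead_coef_factors_F2 :
  (lead_coef p)%:~R = 1 :> 'F_2 /\ (lead_coef r)%:~R = 1 :> 'F_2.
Proof.
apply: F2_mul_eq1; rewrite -rmorphM -lead_coefM -fE.
by rewrite (monicP (recip_quartic_monic A B)).
Qed.

Lemma no_linear_factor : size p != 2.
Proof.
apply/eqP => sp; have [lp _] := lead_coef_factors_F2.
have pE : m2 p = Poly [:: (p`_0)%:~R; 1].
  apply/polyP => i; rewrite coef_map coef_Poly.
  case: i => [|[|i]]; first by [].
    by have := lp; rewrite /lead_coef sp.
  by rewrite /= nth_nil nth_default ?sp.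
have : (m2 p * m2 r).[- (p`_0)%:~R] = 0.
  by rewrite hornerM pE horner_Poly /= mul0r add0r mul1r addNr mul0r.
rewrite factors_F2E horner_Poly.
by case: (F2P (- (p`_0)%:~R)) => -> /eqP.
Qed.

(** Over F_2 the outer coefficients of both factors are 1; the middle ones would have sum 1 and
    product 1. *)
Lemma no_quadratic_factor : size p = 3 -> size r = 3 -> False.
Proof.
move=> sp sr; have [] := lead_coef_factors_F2.
rewrite /lead_coef sp sr /= => lp lr.
have cf i : \sum_(j < i.+1) (p`_j)%:~R * (r`_(i - j))%:~R
    = [:: 1; 1; 1; 1; 1]`_i :> 'F_2.
  have := congr1 (fun q : {poly 'F_2} => q`_i) factors_F2E.
  rewrite coefM (coef_Poly [:: 1; 1; 1; 1; 1]) => <-.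
  by apply: eq_bigr => j _; rewrite !coef_map.
have := cf 0%N; rewrite big_ord_recl big_ord0 /= subn0 addr0 => /F2_mul_eq1[p0 r0].
have := cf 1%N; rewrite !big_ord_recl big_ord0 /= /bump /= addn0 subn0 subnn addr0.
have := cf 2%N; rewrite !big_ord_recl big_ord0 /= /bump /= !addn0 subn0 subnn subSS subn0 addr0.
rewrite p0 r0 lp lr.
by case: (F2P (p`_1)%:~R) => ->; case: (F2P (r`_1)%:~R) => -> /eqP + /eqP.
Qed.

End ReductionModTwo.

Lemma recip_quartic_irr (A B : int) :
  (A = 1 %[mod 4])%Z -> (B = 1 %[mod 4])%Z ->
  irreducible_poly (map_poly intr (recip_quartic A B) : {poly rat}).
Proof.
move=> a b; split; first by rewrite size_recip_quartic_rat.
move=> q sq dv; rewrite -(dvdp_size_eqp dv) size_recip_quartic_rat.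
(* Gauss's lemma: a rational factor comes from an integral factorization, which can be reduced mod
   2. *)
have [p [c c0 qE] [r fE]] := dvdpP_rat_int dv.
have sqp : size q = size p by rewrite qE size_scale // size_rat_int_poly.
have f0 : recip_quartic A B != 0 by rewrite -size_poly_eq0 size_recip_quartic.
have p0 : p != 0 by apply: contraNneq f0 => p0; rewrite fE p0 mul0r.
have r0 : r != 0 by apply: contraNneq f0 => r0; rewrite fE r0 mulr0.
have := size_mul p0 r0; rewrite -fE size_recip_quartic => ssz.
have := no_linear_factor a b fE; have := no_quadratic_factor a b fE.
have := @no_linear_factor A B r p a b; rewrite mulrC -fE => /(_ erefl).
move: sq; rewrite sqp.
move: p0 r0; rewrite -!size_poly_gt0.
move: (size p) (size r) ssz => m n e m0 n0 m1 n2 n3 m2.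
have m3 : ~ (m = 3) by move=> m3; apply: n3 => //; lia.
lia.
Qed.

(** * Rings of integers *)

(** The equations are the coordinates of w^2 = w2 (y + 2) for w = p + q y and w2 = g + h y. Setting
    y = -2 gives (p - 2 q)^2 divisible by f(-1) = B + 2 - 2 A, the norm of y + 2; the conclusion
    says that y + 2 divides w in Z[y]. *)
Lemma norm_divisibility (A B p q g h : int) :
  p ^+ 2 - (B - 2) * q ^+ 2 = 2 * g - (B - 2) * h ->
  2 * p * q - A * q ^+ 2 = g + (2 - A) * h ->
  squarefree (absz (B + 2 - 2 * A)%R) ->
  exists k : int, p = 2 * q + (B + 2 - 2 * A) * k.
Proof.
move=> e1 e2 sq; set c := B + 2 - 2 * A in sq *.
have e : (p - 2 * q) ^+ 2 = (q ^+ 2 - h) * c.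
  transitivity ((p ^+ 2 - (B - 2) * q ^+ 2) - 2 * (2 * p * q - A * q ^+ 2) + c * q ^+ 2).
    by rewrite /c; ring.
  by rewrite e1 e2 /c; ring.
have : (absz c %| absz (p - 2 * q)%R ^ 2)%N by rewrite -abszX e abszM dvdn_mull.
move=> /(squarefree_dvdn_sqr sq) h'.
have /dvdzP[k kE] : (c %| p - 2 * q)%Z by [].
by exists k; rewrite [c * k]mulrC -kE; ring.
Qed.

Section RingOfIntegers.

Variables (L : fieldExtType rat) (I : {rmorphism rat -> L}).
Variables (A B : int) (x : L).
Hypothesis irr : irreducible_poly (map_poly intr (recip_quartic A B) : {poly rat}).
Hypothesis rx : root (map_poly intr (recip_quartic A B)) x.
Hypothesis sqW : squarefree `|trace_disc A B|.
Hypothesis f1 : B + 2 + 2 * A = 1.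
Hypothesis sqf : squarefree (absz (B + 2 - 2 * A)%R).

Let y := x + x^-1.
Let y' := - A%:~R - y.
Let int_over := integralOver (intr : int -> L).

Let intD s t : int_over s -> int_over t -> int_over (s + t).
Proof. exact: (@integral_add _ _ (intr : {rmorphism int -> L})). Qed.

Let intM s t : int_over s -> int_over t -> int_over (s * t).
Proof. exact: (@integral_mul _ _ (intr : {rmorphism int -> L})). Qed.

Let intZ (n : int) : int_over n%:~R.
Proof. exact: (@integral_id _ _ (intr : {rmorphism int -> L})). Qed.

Let intN s : int_over s -> int_over (- s).
Proof. by move=> h; rewrite -mulN1r; apply: intM h; apply: (intZ (-1)). Qed.

Let IE z : I z%:~R = z%:~R. Proof. exact: rmorph_int. Qed.

Let int_y : int_over y. Proof. exact: integral_trace rx. Qed.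

(** The trace T and the norm N are integers with T^2 - 4 N = b^2 W. As W is squarefree, b is an
    integer, and then so is a. *)
Lemma trace_field_integral (a b : rat) : int_over (I a + I b * y) ->
  exists m n : int, a = m%:~R /\ b = n%:~R.
Proof.
move=> h.
have hP z : (map_poly I (Poly [:: a; b])).[z] = I a + I b * z.
  by rewrite horner_map_Poly !big_ord_recl big_ord0 /= /bump /=; ring.
have h' : int_over (I a + I b * y').
  rewrite -hP; apply: (@integral_conj L I (trace_poly A B) (Poly [:: a; b]) y y'
    (trace_poly_irr I irr rx)).
  - exact: (trace_poly_root I rx).
  - exact: (trace_poly_root_conj I rx).
  by rewrite hP.
have [T TE] : exists T : int, 2 * a - A%:~R * b = T%:~R.
  apply: (integral_rat_int (I := I)).
  have -> : I (2 * a - A%:~R * b) = (I a + I b * y) + (I a + I b * y').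
    by rewrite /y'; ring.
  exact: intD.
have [N NE] : exists N : int, trace_norm A B a b = N%:~R.
  apply: (integral_rat_int (I := I)); rewrite -(trace_normE I rx).
  exact: intM.
have [n nE] : exists n : int, b = n%:~R.
  apply: (squarefree_sqr_rat (z := T ^+ 2 - 4 * N) sqW).
  have -> : (T ^+ 2 - 4 * N)%:~R = T%:~R ^+ 2 - 4 * N%:~R :> rat by ring.
  by rewrite -TE -NE /trace_norm /trace_disc; ring.
have [m mE] : exists m : int, a = m%:~R.
  apply: (integral_rat_int (I := I)).
  have -> : I a = (I a + I b * y) + - (n%:~R * y) by rewrite nE IE; ring.
  by apply: intD => //; apply: intN; apply: intM.
by exists m, n.
Qed.

Lemma trace_field_integralP s : in_trace_field I y s -> int_over s ->
  exists m n : int, s = m%:~R + n%:~R * y.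
Proof.
move=> [a [b ->]] /trace_field_integral[m [n [-> ->]]]; exists m, n.
by rewrite !IE.
Qed.

Lemma trace_conj_units : (y - 2) * (y' - 2) = 1.
Proof.
transitivity (y * y' - 2 * (y + y') + 4); first by ring.
rewrite (trace_conj_prod rx) trace_conj_sum -[RHS](_ : 1%:~R = 1) // -f1.
by ring.
Qed.

Lemma trace_conj_norm2 : (y + 2) * (y' + 2) = (B + 2 - 2 * A)%:~R.
Proof.
transitivity (y * y' + 2 * (y + y') + 4); first by ring.
by rewrite (trace_conj_prod rx) trace_conj_sum; ring.
Qed.

(** The map x -> 1/x fixes y. A single rational polynomial [g] takes the value u + v x at x and u +
    v / x at 1/x, so [integral_conj] applies. *)
Lemma quartic_integral_conj (u v : L) :
  in_trace_field I y u -> in_trace_field I y v ->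
  int_over (u + v * x) -> int_over (u + v * x^-1).
Proof.
move=> [a [b ->]] [c [d ->]] h.
pose Y := Poly [:: - A%:~R : rat; - (B%:~R - 1); - A%:~R; -1].
pose g := (Poly [:: a; b]) \Po Y + (Poly [:: c; d] \Po Y) * 'X.
have compE (p1 p2 p3 : {poly rat}) z :
    (map_poly I (p1 \Po p3 + (p2 \Po p3) * 'X)).[z] =
    (map_poly I p1).[(map_poly I p3).[z]] + (map_poly I p2).[(map_poly I p3).[z]] * z.
  rewrite rmorphD rmorphM /= !map_comp_poly map_polyX hornerD hornerM hornerX.
  by rewrite !horner_comp.
have YE z : root (map_poly intr (recip_quartic A B)) z ->
    (map_poly I Y).[z] = z + z^-1.
  move=> rz; rewrite horner_map_Poly !big_ord_recl big_ord0 /= /bump /= !add1n.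
  by rewrite [z + _](trace_cubic rz); ring.
have gE z : root (map_poly intr (recip_quartic A B)) z ->
    (map_poly I g).[z] = I a + I b * (z + z^-1) + (I c + I d * (z + z^-1)) * z.
  move=> rz; rewrite compE YE // !horner_map_Poly !big_ord_recl !big_ord0.
  by rewrite /= /bump /= !add1n; ring.
have rV := quartic_rootV rx.
have := gE _ rV; rewrite invrK [x^-1 + x]addrC -/y => <-.
apply: (integral_conj irr (root_map_quartic I rx) (root_map_quartic I rV)).
by rewrite gE.
Qed.

Lemma quartic_integral_span (z : L) : z \in <<1; x>>%VS -> int_over z ->
  exists a b c d : int,
    z = a%:~R + b%:~R * y + c%:~R * x + d%:~R * (y * x).
Proof.
move=> /(quartic_span I rx)[a [b [c [d]]]]; rewrite -/y => zE Oz.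
have x0 := quartic_root_neq0 rx.
pose u := I a + I b * y; pose v := I c + I d * y.
have Fu : in_trace_field I y u by exists a, b.
have Fv : in_trace_field I y v by exists c, d.
have Fy : in_trace_field I y y by apply: trace_field_gen.
have Fn (n : int) : in_trace_field I y n%:~R by apply: trace_field_int.
have {}zE : z = u + v * x by rewrite zE /u /v; ring.
pose z' := u + v * x^-1.
have Oz' : int_over z' by apply: quartic_integral_conj => //; rewrite -zE.
have Ox := integral_root rx.
have OxV := integral_root (quartic_rootV rx).
have Oy'2 : int_over (y' - 2).
  apply: intD; last by apply: intN; apply: (intZ 2).
  by apply: intD; apply: intN.
(* [y - 2] is a unit with inverse [y' - 2], so integrality of [v (y^2 - 4)] and *)
(* [v^2 (y^2 - 4)], which come from the relative trace and norm, transfers to   *)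
(* [w] and [w2].                                                                *)
pose w := v * (y + 2).
have Ow : int_over w.
  have -> : w = (2%:~R * (z * x + z' * x^-1) - y * (z + z')) * (y' - 2).
    have -> : 2%:~R * (z * x + z' * x^-1) - y * (z + z') = w * (y - 2).
      by rewrite zE /z' /w /y; field.
    by rewrite -mulrA trace_conj_units mulr1.
  apply: intM => //; apply: intD; last by apply: intN; apply: intM => //; apply: intD.
  by apply: intM; [apply: intZ | apply: intD; apply: intM].
have Fw : in_trace_field I y w.
  by apply: (trace_fieldM rx) => //; apply: trace_fieldD => //; apply: (Fn 2).
pose w2 := v ^+ 2 * (y + 2).
have Ow2 : int_over w2.
  have -> : w2 = ((z + z') * (z + z') + - (4%:~R * (z * z'))) * (y' - 2).
    have -> : (z + z') * (z + z') + - (4%:~R * (z * z')) = w2 * (y - 2).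
      by rewrite zE /z' /w2 /y; field.
    by rewrite -mulrA trace_conj_units mulr1.
  apply: intM => //; apply: intD; first by apply: intM; apply: intD.
  by apply: intN; apply: intM; [apply: intZ | apply: intM].
have Fw2 : in_trace_field I y w2.
  apply: (trace_fieldM rx); first by rewrite expr2; apply: (trace_fieldM rx).
  by apply: trace_fieldD => //; apply: (Fn 2).
have [p [q wE]] := trace_field_integralP Fw Ow.
have [g [h w2E]] := trace_field_integralP Fw2 Ow2.
have y2 := trace_eq rx; rewrite -/y in y2.
(* Comparison of coordinates in w^2 = w2 (y + 2). *)
have [|/eqP e1 /eqP e2] := @trace_independent L I A B x irr rx
    (p ^+ 2 - (B - 2) * q ^+ 2 - (2 * g - (B - 2) * h))%:~R
    (2 * p * q - A * q ^+ 2 - (g + (2 - A) * h))%:~R.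
  rewrite -/y; transitivity (w ^+ 2 - w2 * (y + 2)
     - (q%:~R ^+ 2 - h%:~R) * (y ^+ 2 - (- A%:~R * y - (B%:~R - 2)))).
    by rewrite wE w2E; ring.
  by rewrite y2 subrr mulr0 subr0 /w /w2; ring.
move: e1 e2; rewrite !intr_eq0 !subr_eq0 => /eqP e1 /eqP e2.
have [k pE] := norm_divisibility e1 e2 sqf.
have y20 : y + 2 != 0.
  apply/eqP => h0; have [|_ /eqP] := @trace_independent L I A B x irr rx 2 1.
    by rewrite -/y -[RHS]h0; ring.
  by rewrite oner_eq0.
(* Since B + 2 - 2 A = (y + 2)(y' + 2), w = (y + 2)(q + k (y' + 2)), and y' + 2 = 2 - A - y. *)
have vE : v = (q + k * (2 - A))%:~R + (- k)%:~R * y.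
  apply: (mulIf y20); rewrite -/w wE pE.
  rewrite rmorphD (rmorphM _ (B + 2 - 2 * A)) /= -trace_conj_norm2 /y'.
  by ring.
have Ou : int_over u.
  have -> : u = z + - (v * x) by rewrite zE; ring.
  apply: intD => //; apply: intN; apply: intM => //; rewrite vE.
  by apply: intD => //; apply: intM.
have [m [n uE]] := trace_field_integralP Fu Ou.
exists m, n, (q + k * (2 - A)), (- k).
by rewrite zE uE vE; ring.
Qed.

End RingOfIntegers.

Lemma ring_of_integersX (L : fieldExtType rat) (A B : int) (x : L) (i : nat) :
  root (map_poly intr (recip_quartic A B)) x ->
  ring_of_integers <<1; x>>%VS (x ^+ i).
Proof.
move=> rx; split; first by rewrite rpredX // memv_adjoin.
elim: i => [|i ih]; first exact: (@integral1 _ _ (intr : {rmorphism int -> L})).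
rewrite exprS; apply: (@integral_mul _ _ (intr : {rmorphism int -> L})) => //.
exact: integral_root rx.
Qed.

Lemma monogenic_recip_quartic (A B : int) :
  (A = 1 %[mod 4])%Z -> (B = 1 %[mod 4])%Z -> B + 2 + 2 * A = 1 ->
  squarefree `|trace_disc A B| -> squarefree (absz (B + 2 - 2 * A)%R) ->
  monogenic (recip_quartic A B).
Proof.
move=> a b f1 sqW sqf; have irr := recip_quartic_irr a b.
split => //; first exact: recip_quartic_monic.
move=> L x rx; rewrite size_recip_quartic.
split => [i|c|z [zK Oz]]; first exact: ring_of_integersX rx.
- under eq_bigr do rewrite -mulrzr.
  pose s := [:: c 0; c 1; c 2; c 3].
  have cE (i : 'I_4) : c i = s`_i.
    by case: i => [[|[|[|[|//]]]] hi]; congr (c _); apply/val_inj.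
  move=> h i; pose p : {poly rat} := Poly [seq k%:~R | k <- s].
  have p0 : p = 0.
    apply: (irreducible_small_root irr (root_map_quartic (in_alg L) rx)).
      by rewrite size_recip_quartic_rat (leq_ltn_trans (size_Poly _)).
    rewrite rootE horner_map_Poly size_map -[X in _ == X]h; apply/eqP.
    apply: eq_bigr => j _; rewrite (nth_map 0) // cE mulrC.
    by congr (_ * _); apply: (rmorph_int (in_alg L)).
  apply: (@intr_inj rat); rewrite cE rmorph0 -(nth_map _ 0) //.
  by rewrite -coef_Poly -/p p0 coef0.
have [m [n [k [l ->]]]] := quartic_integral_span (in_alg L) irr rx sqW f1 sqf zK Oz.
exists (fun i => [:: m - A * n + l; k - (B - 1) * n; l - A * n; - n]`_i).
under eq_bigr do rewrite -mulrzr.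
have x0 := quartic_root_neq0 rx.
have -> : (x + x^-1) * x = x ^+ 2 + 1 by field.
rewrite (trace_cubic rx) !big_ord_recl big_ord0 /= /bump /= !add1n.
by ring.
Qed.

(** * The Galois group *)

Lemma dim_adjoin_quartic (L : fieldExtType rat) (A B : int) (x : L) :
  irreducible_poly (map_poly intr (recip_quartic A B) : {poly rat}) ->
  root (map_poly intr (recip_quartic A B)) x -> \dim <<1; x>> = 4.
Proof.
move=> irr rx; apply/eqP; rewrite eqn_leq (dim_adjoin_le4 rx) /=.
rewrite dim_Fadjoin dimv1 muln1 -ltnS -size_minPoly.
have /polyOver1P[q qE] := minPolyOver 1 x.
have q0 : q != 0.
  by rewrite -(map_poly_eq0 (in_alg L)) -qE monic_neq0 // monic_minPoly.
have : root (map_poly (in_alg L) q) x by rewrite -qE root_minPoly.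
move=> /(irreducible_root_dvdp irr (root_map_quartic (in_alg L) rx)).
by move=> /(dvdp_leq q0); rewrite qE size_map_poly size_recip_quartic_rat.
Qed.

Section GaloisD8.

Variables (L : splittingFieldType rat) (A B : int) (x1 x2 : L).
Hypothesis irr : irreducible_poly (map_poly intr (recip_quartic A B) : {poly rat}).
Hypothesis rx1 : root (map_poly intr (recip_quartic A B)) x1.
Hypothesis rx2 : root (map_poly intr (recip_quartic A B)) x2.
Hypothesis sum_traces : x2 + x2^-1 = - A%:~R - (x1 + x1^-1).
Hypothesis genL : <<1 & [:: x1; x2]>>%VS = {:L}%VS.
Hypothesis x2_notin : x2 \notin <<1; x1>>%VS.

Let x10 : x1 != 0. Proof. exact: quartic_root_neq0 rx1. Qed.
Let x20 : x2 != 0. Proof. exact: quartic_root_neq0 rx2. Qed.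

Lemma trace_root_cases (z x : L) : x != 0 -> z != 0 ->
  z + z^-1 = x + x^-1 -> z = x \/ z = x^-1.
Proof.
move=> x0 z0 e; have /eqP : (z - x) * (z - x^-1) = 0.
  apply: (mulIf (invr_neq0 z0)); rewrite mul0r.
  transitivity ((z + z^-1) - (x + x^-1)); last by rewrite e subrr.
  by field; rewrite z0 x0.
by rewrite mulf_eq0 !subr_eq0 => /orP[] /eqP; [left | right].
Qed.

(** The trace of x2 lies in Q(x1), so x2 is quadratic over Q(x1), of degree exactly 2 because it is
    not in that field. *)
Lemma dim_splitting_field : \dim {:L} = 8.
Proof.
have -> : {:L}%VS = <<<<1; x1>>; x2>>%VS by rewrite -genL adjoin_cons adjoin_seq1.
rewrite dim_Fadjoin (dim_adjoin_quartic irr rx1).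
suff -> : adjoin_degree <<1; x1>> x2 = 2 by [].
have : adjoin_degree <<1; x1>> x2 != 1 by rewrite adjoin_deg_eq1.
have : (adjoin_degree <<1; x1>> x2 <= 2)%N.
  pose q : {poly L} := Poly [:: 1; - (x2 + x2^-1); 1].
  have sq : size q = 3 by rewrite (@PolyK _ 0) //= oner_eq0.
  rewrite -ltnS -size_minPoly; apply: (@leq_trans (size q)); last by rewrite sq.
  apply: dvdp_leq.
    by rewrite -size_poly_eq0 sq.
  apply: minPoly_dvdp.
    have x1K : x1 \in <<1; x1>>%VS by apply: memv_adjoin.
    have yK : x2 + x2^-1 \in <<1; x1>>%VS.
      by rewrite sum_traces rpredB ?rpredN ?rpred_int // rpredD // rpredV.
    apply/polyOverP => i; rewrite coef_Poly.
    by case: i => [|[|[|i]]] /=; rewrite ?nth_nil ?rpredN ?rpred1 ?rpred0.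
  by rewrite rootE horner_Poly /=; apply/eqP; field.
by rewrite /adjoin_degree /=; lia.
Qed.

Lemma card_galois_group : #|'Gal({:L} / 1)%g| = 8.
Proof.
by rewrite -(galois_dim (galois_rat 1%AS)) dim_splitting_field dimv1.
Qed.

Lemma galois_eq (g h : gal_of {:L}) : g x1 = h x1 -> g x2 = h x2 -> g = h.
Proof.
move=> e1 e2; apply: (mulIg h^-1)%g; rewrite mulgV.
have fix_gen a : g a = h a -> a \in fixedField [set (g * h^-1)%g].
  move=> e; apply/fixedFieldP; rewrite ?memvf // => k /set1P ->.
  by rewrite galM ?memvf // e -galM ?memvf // mulgV gal_id.
have : (<<1 & [:: x1; x2]>> <= fixedField [set (g * h^-1)%g])%VS.
  apply/Fadjoin_seqP; split; first exact: sub1v.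
  by move=> a; rewrite !inE => /orP[] /eqP ->; apply: fix_gen.
rewrite genL => /subvP sub; apply/eqP/gal_eqP => a _.
rewrite gal_id; apply: (fixedFieldP (memvf a) (sub a (memvf a))).
exact: set11.
Qed.

Lemma gal_trace (g : gal_of {:L}) (z : L) :
  g (z + z^-1) = g z + (g z)^-1.
Proof. by rewrite rmorphD fmorphV. Qed.

Lemma gal_other_trace (g : gal_of {:L}) :
  g (x2 + x2^-1) = - A%:~R - g (x1 + x1^-1).
Proof. by rewrite sum_traces rmorphB rmorphN rmorph_int. Qed.

(** The nontrivial automorphism over Q(x2) fixes both traces, so it sends x1 to x1 or 1/x1; the
    first choice would make it the identity. *)
Lemma exists_inversion : exists t : gal_of {:L},
  [/\ t \in 'Gal({:L} / 1)%g, t x1 = x1^-1 & t x2 = x2].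
Proof.
have card2 : #|'Gal({:L} / <<1; x2>>)%g| = 2.
  rewrite -(galois_dim (galois_rat <<1; x2>>%AS)) dim_splitting_field.
  by rewrite (dim_adjoin_quartic irr rx2).
have /trivgPn[t tG t1] : 'Gal({:L} / <<1; x2>>)%g != 1%g.
  by rewrite -cardG_gt1 card2.
have t2 : t x2 = x2 by rewrite (fixed_gal (subvf _) tG) ?memv_adjoin.
exists t; split => //.
  have sub : 'Gal({:L} / <<1; x2>>)%g \subset 'Gal({:L} / 1)%g by apply: galS; apply: sub1v.
  exact: (fintype.subsetP sub).
have [||||] := @trace_root_cases (t x1) x1; rewrite ?fmorph_eq0 //.
  rewrite -gal_trace.
  have /eqP := gal_other_trace t; rewrite gal_trace t2 sum_traces.
  by rewrite eq_sym (inj_eq (addrI _)) eqr_opp => /eqP.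
move=> e; case/eqP: t1; apply: galois_eq; by rewrite gal_id.
Qed.

(** Irreducibility gives an automorphism sending x1 to x2. It sends x2 to x1 or 1/x1, and the second
    case is corrected by the inversion. *)
Lemma exists_swap : exists s : gal_of {:L},
  [/\ s \in 'Gal({:L} / 1)%g, s x1 = x2 & s x2 = x1].
Proof.
have rm : root (minPoly 1 x1) x2.
  have /polyOver1P[q qE] := minPolyOver 1 x1.
  rewrite qE; apply: (irreducible_conj irr (root_map_quartic _ rx1)).
    exact: root_map_quartic.
  by rewrite -qE root_minPoly.
have [s sG s1] := normalField_root_minPoly (subvf 1) (normalFieldf 1) (memvf x1) rm.
have [||||s2] := @trace_root_cases (s x2) x1; rewrite ?fmorph_eq0 //.
- rewrite -gal_trace gal_other_trace gal_trace s1 sum_traces.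
  by ring.
- by move=> s2; exists s.
have [t [tG t1 t2]] := exists_inversion.
exists (s * t)%g; split; first exact: groupM.
  by rewrite galM ?memvf // s1 t2.
by rewrite galM ?memvf // s2 fmorphV /= t1 invrK.
Qed.

(** Two distinct involutions generate a dihedral group; as they do not commute and groups of order
    1, 2 or 4 are abelian, it is the whole group. *)
Lemma galois_group_D8 : 'Gal({:L} / 1) \isog 'D_(8%N).
Proof.
have [t [tG t1 t2]] := exists_inversion.
have [s [sG s1 s2]] := exists_swap.
have x12 : x1 != x2 by apply: contraNneq x2_notin => <-; apply: memv_adjoin.
have x1V : x1 != x1^-1.
  apply/eqP => h; case: (@root_not_in_trace_field L (in_alg L) A B x1 irr rx1).
  exists 0, 2^-1; rewrite rmorph0 add0r fmorphV (rmorph_nat (in_alg L)) -h.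
  by have := two_neq0 (in_alg L) => two0; field.
have tt : (t * t = 1)%g.
  by apply: galois_eq; rewrite galM ?memvf // gal_id ?t1 ?t2 // fmorphV /= t1 invrK.
have ss : (s * s = 1)%g.
  by apply: galois_eq; rewrite galM ?memvf // gal_id ?s1 ?s2.
have st : (s * t <> t * s)%g.
  move=> e; have : (s * t)%g x1 = (t * s)%g x1 by rewrite e.
  rewrite !galM ?memvf // s1 t1 t2 fmorphV /= s1 => h; case/eqP: x1V.
  by rewrite -s2 -fmorphV -h.
have order2 (gT : finGroupType) (g : gT) : (g * g = 1)%g -> g != 1%g -> #[g]%g = 2.
  move=> gg g1; apply: nt_prime_order => //.
have t_neq1 : t != 1%g by apply/eqP => e; apply: st; rewrite e mulg1 mul1g.
have s_neq1 : s != 1%g by apply/eqP => e; apply: st; rewrite e mulg1 mul1g.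
have t_neq_s : t != s by apply/eqP => e; apply: st; rewrite e.
have := involutions_gen_dihedral (order2 _ _ tt t_neq1) (order2 _ _ ss s_neq1) t_neq_s.
set G := <<_>>%g => iso.
have sub : G \subset 'Gal({:L} / 1)%g.
  by rewrite gen_subG; apply/fintype.subsetP => g /set2P[] ->.
have tG' : t \in G by rewrite mem_gen // set21.
have sG' : s \in G by rewrite mem_gen // set22.
have nab : ~~ abelian G.
  by apply/negP => /centsP/(_ s sG' t tG').
have c8 : #|G| = 8.
  have := cardSg sub; rewrite card_galois_group => dv.
  apply/eqP; rewrite eqn_leq (dvdn_leq _ dv) //= leqNgt.
  apply: contra nab => lt8; apply: (@p2group_abelian _ 2).
    by rewrite /pgroup (pnat_dvd dv).
  by move: dv lt8; move: #|G| => [|[|[|[|[|[|[|[|//]]]]]]]].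
rewrite c8 in iso.
rewrite (_ : 'Gal(_ / _)%g = G) //; apply/eqP.
by rewrite eq_sym eqEcard sub card_galois_group c8.
Qed.

End GaloisD8.

(** * Two pairs with the same field *)

Section SameField.

Variables (L : fieldExtType rat) (I : {rmorphism rat -> L}).
Variables (Ai Bi Aj Bj : int) (xi xj : L).
Hypothesis mono_i : monogenic (recip_quartic Ai Bi).
Hypothesis irr_j :
  irreducible_poly (map_poly intr (recip_quartic Aj Bj) : {poly rat}).
Hypothesis nsq_i : forall r : rat, r ^+ 2 <> (rel_disc_norm Ai Bi)%:~R.
Hypothesis rxi : root (map_poly intr (recip_quartic Ai Bi)) xi.
Hypothesis rxj : root (map_poly intr (recip_quartic Aj Bj)) xj.
Hypothesis eqK : <<1; xi>>%VS = <<1; xj>>%VS.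

Let yi := xi + xi^-1.
Let yj := xj + xj^-1.

Let irr_i : irreducible_poly (map_poly intr (recip_quartic Ai Bi) : {poly rat}).
Proof. by case: mono_i. Qed.

Lemma trace_disc_sqr (A B : int) (x : L) :
  root (map_poly intr (recip_quartic A B)) x ->
  (2 * (x + x^-1) + A%:~R) ^+ 2 = (trace_disc A B)%:~R.
Proof.
move=> rx; set y := x + x^-1.
transitivity (4 * y ^+ 2 + 4 * A%:~R * y + A%:~R ^+ 2); first by ring.
by rewrite /y (trace_eq rx) /trace_disc; ring.
Qed.

(** The square root 2 yj + Aj of Wj lies in Q(yi), and monogenicity makes the coordinates of yj
    integral. Writing 2 yj + Aj = e + b (2 yi + Ai), rationality of its square gives e b = 0, and b
    is nonzero because yj is irrational. *)
Lemma trace_relation : exists a b : int,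
  [/\ yj = a%:~R + b%:~R * yi, 2 * a + Aj = b * Ai
    & trace_disc Aj Bj = b ^+ 2 * trace_disc Ai Bi].
Proof.
have yjK : yj \in <<1; xi>>%VS by rewrite eqK; apply: trace_in.
have [||e1 [e2 eE]] := @sqrt_in_trace_field L I Ai Bi xi irr_i rxi
  (2 * yj + Aj%:~R) (trace_disc Aj Bj)%:~R nsq_i.
- by apply: rpredD; [apply: rpredM => //; apply: rpred_nat | apply: rpred_int].
- by rewrite [RHS](rmorph_int I); apply: trace_disc_sqr.
have [a [b [c [d abcd]]]] : exists a b c d : int, yj = a%:~R + b%:~R * yi + c%:~R * xi
                             + d%:~R * (yi * xi).
  by apply: (quartic_int_span mono_i rxi); split=> //; apply: integral_trace rxj.
have [|_ _ c0 d0] := @quartic_independent L I Ai Bi xi irr_i rxi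
    (2 * a%:~R + Aj%:~R - e1) (2 * b%:~R - e2) (2 * c%:~R) (2 * d%:~R).
  rewrite -/yi -[RHS](subrr (2 * yj + Aj%:~R)) {2}eE -/yi abcd; ring.
have {c0} c0 : c = 0 by move: c0 => /eqP; rewrite mulf_eq0 intr_eq0 => /eqP.
have {d0} d0 : d = 0 by move: d0 => /eqP; rewrite mulf_eq0 intr_eq0 => /eqP.
have yjE : yj = a%:~R + b%:~R * yi by rewrite abcd c0 d0 !mul0r !addr0.
pose e := 2 * a + Aj - b * Ai.
have sE : 2 * yj + Aj%:~R = e%:~R + b%:~R * (2 * yi + Ai%:~R).
  by rewrite yjE /e; ring.
have W_eq : I (trace_disc Aj Bj)%:~R = I (e ^+ 2 + b ^+ 2 * trace_disc Ai Bi)%:~R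
    + I (2 * e * b)%:~R * (2 * yi + Ai%:~R).
  rewrite !(rmorph_int I) -(trace_disc_sqr rxj) -/yj sE.
  transitivity (e%:~R ^+ 2 + 2 * e%:~R * b%:~R * (2 * yi + Ai%:~R)
    + b%:~R ^+ 2 * (2 * yi + Ai%:~R) ^+ 2); first by ring.
  by rewrite [(2 * yi + _) ^+ 2](trace_disc_sqr rxi); ring.
have [|eW /eqP] := @trace_independent L I Ai Bi xi irr_i rxi
   ((e ^+ 2 + b ^+ 2 * trace_disc Ai Bi + 2 * e * b * Ai)%:~R - (trace_disc Aj Bj)%:~R)
   (4 * e * b)%:~R.
  by rewrite rmorphB W_eq -/yi; ring.
rewrite intr_eq0 mulf_eq0 => eb.
have b0 : b != 0.
  apply/eqP => b0; have [|_ /eqP] := @trace_independent L I Aj Bj xj irr_j rxj (- a%:~R) 1.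
    by rewrite -/yj yjE b0; ring.
  by rewrite oner_eq0.
have e0 : e = 0.
  by move: eb; rewrite (negPf b0) orbF mulf_eq0 => /eqP.
exists a, b; split => //.
  by apply/eqP; rewrite -subr_eq0 -/e e0.
apply: (@intr_inj rat); apply/eqP; rewrite -subr_eq0 -oppr_eq0 opprB -[X in _ == X]eW e0.
by apply/eqP; ring.
Qed.

(** Write xj = u + v xi with u, v in Z[yi]. The equation xj^2 - yj xj + 1 = 0 yields yj = 2 u + v yi
    and v^2 (yi^2 - 4) = yj^2 - 4; taking norms, n is the norm of v. *)
Lemma relative_disc_relation :
  exists n : int, rel_disc_norm Aj Bj = n ^+ 2 * rel_disc_norm Ai Bi.
Proof.
have [a [b [yjE abA _]]] := trace_relation.
have [a0 [b0 [c [d xE]]]] : exists a b c d : int, xj = a%:~R + b%:~R * yi + c%:~R * xi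
                             + d%:~R * (yi * xi).
  apply: (quartic_int_span mono_i rxi); split; last exact: integral_root rxj.
  by rewrite eqK memv_adjoin.
pose u : L := a0%:~R + b0%:~R * yi; pose v : L := c%:~R + d%:~R * yi.
have IE z : I z%:~R = z%:~R := rmorph_int I z.
have Fu : in_trace_field I yi u by exists a0%:~R, b0%:~R; rewrite !IE.
have Fv : in_trace_field I yi v by exists c%:~R, d%:~R; rewrite !IE.
have Fyj : in_trace_field I yi yj by exists a%:~R, b%:~R; rewrite !IE.
have Fyi : in_trace_field I yi yi by apply: trace_field_gen.
have xjE : xj = u + v * xi by rewrite xE /u /v; ring.
have [|||e0 /eqP] := @trace_field_independent L I Ai Bi xi irr_i rxi
    (u * u + - (v * v) + - (yj * u) + 1%:~R) (v * (u + u + v * yi + - yj)).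
- apply: trace_fieldD; last exact: trace_field_int.
  apply: trace_fieldD; last by apply: trace_fieldN; apply: (trace_fieldM rxi).
  by apply: trace_fieldD; last apply: trace_fieldN; apply: (trace_fieldM rxi).
- apply: (trace_fieldM rxi) => //; apply: trace_fieldD; last exact: trace_fieldN.
  by apply: trace_fieldD; [apply: trace_fieldD | apply: (trace_fieldM rxi)].
- have := sqr_root rxj; have := sqr_root rxi; rewrite -/yi -/yj xjE => xi2 xj2.
  transitivity (((u + v * xi) ^+ 2 - (yj * (u + v * xi) - 1))
    - v ^+ 2 * (xi ^+ 2 - (yi * xi - 1))).
    by ring.
  by rewrite xj2 xi2 !subrr mulr0 subr0.
rewrite mulf_eq0 => /orP[/eqP v0|/eqP e1].
  (* If v = 0, then xj = u satisfies a rational quadratic equation, against the independence of 1,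
     xj and yj xj. *)
  have uq : u ^+ 2 = I (2 * a0 - Ai * b0)%:~R * u
      - I (trace_norm Ai Bi a0%:~R b0%:~R).
    apply/eqP; rewrite -subr_eq0; apply/eqP.
    transitivity (b0%:~R ^+ 2 * (yi ^+ 2 - (- Ai%:~R * yi - (Bi%:~R - 2)))).
      by rewrite /u /trace_norm; ring.
    by rewrite /yi (trace_eq rxi) subrr mulr0.
  have [|_ _ _ /eqP] := @quartic_independent L I Aj Bj xj irr_j rxj
     (-1 + trace_norm Ai Bi a0%:~R b0%:~R) 0 (- (2 * a0 - Ai * b0)%:~R) 1.
    rewrite -/yj; have := sqr_root rxj; rewrite -/yj xjE v0 mul0r addr0 uq => h.
    apply/eqP; rewrite -(subrr (yj * u - 1)) -{2}h; apply/eqP; ring.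
  by rewrite oner_eq0.
have yju : yj = 2 * u + v * yi.
  by apply/eqP; rewrite eq_sym -subr_eq0 -e1; apply/eqP; ring.
have dE : v ^+ 2 * (yi ^+ 2 - 4) = yj ^+ 2 - 4.
  apply/eqP; rewrite -subr_eq0 -[X in _ == X](mulr0 4) -e0 yju; apply/eqP.
  ring.
have pE z : (map_poly I (Poly [:: a%:~R ; b%:~R] ^+ 2 - Poly [:: 4])).[z] =
   (a%:~R + b%:~R * z) ^+ 2 - 4.
  rewrite rmorphB rmorphXn hornerD hornerN horner_exp.
  rewrite !horner_map_Poly !big_ord_recl !big_ord0 /= /bump /= !add1n !IE.
  by rewrite (rmorph_nat I); ring.
have := @rel_disc_norm_sqr L I Ai Bi xi irr_i rxi
   (Poly [:: a%:~R ; b%:~R] ^+ 2 - Poly [:: 4]) c%:~R d%:~R.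
rewrite -/yi !pE !IE -yjE => /(_ dE).
(* The relation 2 a + Aj = b Ai matches the conjugate of yi with that of yj. *)
have -> : a%:~R + b%:~R * (- Ai%:~R - yi) = - Aj%:~R - yj :> L.
  have -> : Aj = b * Ai - 2 * a by rewrite -abA; ring.
  by rewrite yjE; ring.
rewrite (rel_disc_normE rxj) => h.
exists (c ^+ 2 - Ai * c * d + (Bi - 2) * d ^+ 2).
apply: (@intr_inj rat); apply: (fmorph_inj I); rewrite IE -h -(IE (rel_disc_norm Ai Bi)).
by rewrite /trace_norm; ring.
Qed.

End SameField.

(** * From the two invariants back to the pair *)

(* The two hypotheses force [m] to be a unit of Z. *)
Lemma sqr_scaling_eq (u v m n : int) :
  u != 0 -> v = m ^+ 2 * u -> u = n ^+ 2 * v -> u = v.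
Proof.
move=> u0 vE uE.
have : u * (1 - (n * m) ^+ 2) = 0 by rewrite exprMn mulrBr mulr1 {1}uE vE; ring.
move=> /eqP; rewrite mulf_eq0 (negPf u0) /= subr_eq0 eq_sym sqrf_eq1 => h.
have : (m %| 1)%Z.
  apply/dvdzP; case/orP: h => /eqP h; [exists n | exists (- n)]; first by rewrite h.
  by rewrite mulNr h opprK.
rewrite dvdz1 => /eqP m1; have [mE|mE] : m = 1 \/ m = -1 by lia.
  by rewrite vE mE expr1n mul1r.
by rewrite vE mE sqrrN expr1n mul1r.
Qed.

(** In C + 4 W the terms in A cancel, leaving (B - B')(B + B' - 12) = 0. Modulo 4 both B + B' and A
    + A' are 2, which excludes the second factor here and in (A - A')(A + A') = 0. *)
Lemma recip_pair_of_discs (A B A' B' : int) :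
  (A = 1 %[mod 4])%Z -> (B = 1 %[mod 4])%Z ->
  (A' = 1 %[mod 4])%Z -> (B' = 1 %[mod 4])%Z ->
  trace_disc A B = trace_disc A' B' -> rel_disc_norm A B = rel_disc_norm A' B' ->
  (A, B) = (A', B').
Proof.
move=> a b a' b'; rewrite /trace_disc /rel_disc_norm => w c.
have /eqP : (B - B') * (B + B' - 12) = 0.
  have -> : (B - B') * (B + B' - 12)
    = ((B + 2) ^+ 2 - 4 * A ^+ 2) - ((B' + 2) ^+ 2 - 4 * A' ^+ 2)
     + 4 * ((A ^+ 2 - 4 * B + 8) - (A' ^+ 2 - 4 * B' + 8)) by ring.
  by rewrite w c; ring.
rewrite mulf_eq0 => /orP[/eqP e|/eqP e]; last by lia.
have eB : B = B' by apply/eqP; rewrite -subr_eq0 e.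
subst B'.
have /eqP : (A - A') * (A + A') = 0.
  by move: w; lia.
rewrite mulf_eq0 => /orP[/eqP e1|/eqP e1]; last by lia.
by have -> : A = A' by lia.
Qed.

Lemma fields_distinct (Ai Bi Aj Bj : int) :
  monogenic_D4_pair Ai Bi -> monogenic_D4_pair Aj Bj -> (Ai, Bi) <> (Aj, Bj) ->
  forall (L : fieldExtType rat) (thetai thetaj : L),
    root (map_poly intr (recip_quartic Ai Bi)) thetai ->
    root (map_poly intr (recip_quartic Aj Bj)) thetaj ->
    <<1; thetai>>%VS <> <<1; thetaj>>%VS.
Proof.
move=> [ai bi mi Di] [aj bj mj Dj] neq L xi xj ri rj eqK; apply: neq.
have [_ irri _] := mi; have [_ irrj _] := mj.
have nsi := D8_rel_disc_norm_nonsquare irri Di.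
have nsj := D8_rel_disc_norm_nonsquare irrj Dj.
have [_ [b [_ _ Wj]]] := trace_relation (in_alg L) mi irrj nsi ri rj eqK.
have [_ [b' [_ _ Wi]]] := trace_relation (in_alg L) mj irri nsj rj ri (esym eqK).
have [n Cj] := relative_disc_relation (in_alg L) mi irrj nsi ri rj eqK.
have [n' Ci] := relative_disc_relation (in_alg L) mj irri nsj rj ri (esym eqK).
apply: recip_pair_of_discs => //.
  apply: sqr_scaling_eq Wj Wi; apply/eqP => W0.
  have := trace_disc_sqr ri; rewrite W0 => /eqP; rewrite expf_eq0 /= => /eqP e.
  have [|_ /eqP] := @trace_independent L (in_alg L) Ai Bi xi irri ri Ai%:~R 2.
    by rewrite -[RHS]e; ring.
  by rewrite pnatr_eq0.
apply: sqr_scaling_eq Cj Ci; apply/eqP => C0.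
by apply: (nsi 0); rewrite C0 expr0n.
Qed.

(** * Real and nonreal roots, and the splitting field *)

Lemma map_poly_intr_comp (R S : nzRingType) (g : {rmorphism R -> S}) (p : {poly int}) :
  map_poly g (map_poly intr p) = map_poly intr p.
Proof. by rewrite -map_poly_comp; apply: eq_map_poly => z; exact: (rmorph_int g). Qed.

(** W > 0 makes both traces real, and C < 0 gives y^2 - 4 and y'^2 - 4 opposite signs; y is the
    trace for which it is positive. *)
Lemma real_traces_of_opposite_type (A B : int) :
  0 < trace_disc A B -> rel_disc_norm A B < 0 ->
  exists y : algC, [/\ y \is Num.real, y ^+ 2 + A%:~R * y + (B%:~R - 2) = 0,
    0 < y ^+ 2 - 4 & (- A%:~R - y) ^+ 2 - 4 < 0].
Proof.
move=> W0 C0; pose s : algC := sqrtC (trace_disc A B)%:~R.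
have s2 : s ^+ 2 = (trace_disc A B)%:~R by rewrite sqrtCK.
have sR : s \is Num.real by rewrite sqrtC_real // ler0z ltW.
pose y : algC := (- A%:~R - s) / 2.
have yR : y \is Num.real.
  by rewrite rpredM ?rpredV ?rpred_nat // rpredB // rpredN rpred_int.
have yE : y ^+ 2 + A%:~R * y + (B%:~R - 2) = 0.
  transitivity ((s ^+ 2 - (trace_disc A B)%:~R) / 4); first by rewrite /y /trace_disc; field.
  by rewrite s2 subrr mul0r.
have dC : (y ^+ 2 - 4) * ((- A%:~R - y) ^+ 2 - 4) < 0.
  have -> : (y ^+ 2 - 4) * ((- A%:~R - y) ^+ 2 - 4) = (rel_disc_norm A B)%:~R.
    apply/eqP; rewrite -subr_eq0.
    rewrite -[X in _ == X](mul0r (y ^+ 2 + A%:~R * y - B%:~R - 6)) -yE.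
    by apply/eqP; rewrite /rel_disc_norm; ring.
  by rewrite ltrz0.
have y'R : - A%:~R - y \is Num.real by rewrite rpredB // rpredN rpred_int.
have dR (z : algC) : z \is Num.real -> z ^+ 2 - 4 \is Num.real.
  by move=> zR; rewrite rpredB ?rpredX // rpred_nat.
have [d0|d0|d0] := real_ltgtP (dR _ yR) (rpred0 _).
- exists (- A%:~R - y); split => //.
  + by rewrite -[RHS]yE; ring.
  + by rewrite -(nmulr_rlt0 _ d0).
  + by have -> : - A%:~R - (- A%:~R - y) = y by ring.
- exists y; split => //.
  by rewrite -(pmulr_rlt0 _ d0).
- by move: dC; rewrite d0 mul0r ltxx.
Qed.

Lemma quartic_root_of_trace (A B : int) (y e : algC) :
  y ^+ 2 + A%:~R * y + (B%:~R - 2) = 0 -> e ^+ 2 = y ^+ 2 - 4 ->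
  root (map_poly intr (recip_quartic A B)) ((y + e) / 2) /\
  (y + e) / 2 + ((y + e) / 2)^-1 = y.
Proof.
move=> yE eE; set x := (y + e) / 2.
have x2 : x ^+ 2 - y * x + 1 = 0.
  transitivity ((e ^+ 2 - (y ^+ 2 - 4)) / 4); first by rewrite /x; field.
  by rewrite eE subrr mul0r.
have rx : root (map_poly intr (recip_quartic A B)) x.
  rewrite rootE horner_recip_quartic; apply/eqP.
  transitivity ((x ^+ 2 - y * x + 1) * (x ^+ 2 + (A%:~R + y) * x + 1)
     + (y ^+ 2 + A%:~R * y + (B%:~R - 2)) * x ^+ 2); first by ring.
  by rewrite x2 yE !mul0r addr0.
split => //; have x0 : x != 0.
  by apply/eqP => x0; move/eqP: x2; rewrite x0 expr0n mulr0 subr0 add0r oner_eq0.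
apply: (mulIf x0); apply/eqP; rewrite -subr_eq0 -x2; apply/eqP.
by field.
Qed.

Lemma real_adjoin (Q : fieldExtType rat) (I : {rmorphism rat -> Q})
    (g : {rmorphism Q -> algC}) (A B : int) (x z : Q) :
  root (map_poly intr (recip_quartic A B)) x ->
  g x \is Num.real -> z \in <<1; x>>%VS -> g z \is Num.real.
Proof.
move=> rx xR /(quartic_span I rx)[a [b [c [d ->]]]].
set y := x + x^-1.
have rat_real r : g (I r) \is Num.real.
  by rewrite [g _](fmorph_eq_rat (g \o I)) rpred_rat.
have yR : g y \is Num.real by rewrite rmorphD fmorphV rpredD ?rpredV.
clearbody y; rewrite !(rmorphD g) !(rmorphM g).
by rewrite rpredD ?rpredM // rpredD ?rpredM // rpredD ?rpredM.
Qed.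

(** The number field generated by a real root t1 and a nonreal root t2 splits f. Elements of Q(t1)
    are real, so t2 lies outside it, as [galois_group_D8] requires. *)
Lemma galois_group_recip_quartic (A B : int) :
  irreducible_poly (map_poly intr (recip_quartic A B) : {poly rat}) ->
  0 < trace_disc A B -> rel_disc_norm A B < 0 ->
  galois_group_is (recip_quartic A B) 'D_(8%N)%G.
Proof.
move=> irr W0 C0; have [y [yR yE d1 d2]] := real_traces_of_opposite_type W0 C0.
pose y' : algC := - A%:~R - y.
have y'E : y' ^+ 2 + A%:~R * y' + (B%:~R - 2) = 0 by rewrite -[RHS]yE /y'; ring.
have [] := quartic_root_of_trace yE (sqrtCK _).
have [] := quartic_root_of_trace y'E (sqrtCK _).
set t2 := _ / 2; set t1 := (y + _) / 2 => rt2 t2E rt1 t1E.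
have t1R : t1 \is Num.real.
  by rewrite rpredM ?rpredV ?rpred_nat // rpredD // sqrtC_real // ltW.
have t2R : t2 \isn't Num.real.
  apply/negP => h; have : 2 * t2 - y' \is Num.real.
    have y'R : y' \is Num.real by rewrite rpredB // rpredN rpred_int.
    by rewrite rpredB // rpredM // rpred_nat.
  rewrite realEsqr; have -> : 2 * t2 - y' = sqrtC (y' ^+ 2 - 4) by rewrite /t2; field.
  by rewrite sqrtCK => /le_lt_trans/(_ d2); rewrite ltxx.
have [Q [QC [[|x1 [|x2 []]] // [e1 e2] genQ]]] := num_field_exists [:: t1; t2].
have rQ z : root (map_poly intr (recip_quartic A B)) (QC z) ->
    root (map_poly intr (recip_quartic A B)) z.
  by rewrite -(map_poly_intr_comp QC) fmorph_root.
have rx1 : root (map_poly intr (recip_quartic A B)) x1 by apply: rQ; rewrite e1.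
have rx2 : root (map_poly intr (recip_quartic A B)) x2 by apply: rQ; rewrite e2.
have sumE : x2 + x2^-1 = - A%:~R - (x1 + x1^-1).
  apply: (fmorph_inj QC); rewrite !(rmorphD, rmorphN, fmorphV, rmorph_int) /=.
  by rewrite e1 e2 t2E -opprD t1E opprD.
have nin : x2 \notin <<1; x1>>%VS.
  apply: contra t2R => x2K; rewrite -e2.
  by apply: (real_adjoin (in_alg Q) rx1 _ x2K); rewrite e1.
pose rs := [:: x1; x1^-1; x2; x2^-1].
have fE : map_poly intr (recip_quartic A B) = \prod_(z <- rs) ('X - z%:P).
  have x10 := quartic_root_neq0 rx1; have x20 := quartic_root_neq0 rx2.
  pose c z : {poly Q} := z%:P.
  transitivity (('X ^+ 2 - c (x1 + x1^-1) * 'X + 1)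
    * ('X ^+ 2 - c (x2 + x2^-1) * 'X + 1)).
    rewrite map_recip_quartic -!mul_polyC sumE.
    have := trace_eq rx1; set z := x1 + x1^-1 => zE.
    have BE : B%:~R = 2 - A%:~R * z - z ^+ 2 by rewrite zE; ring.
    by rewrite BE /c; ring.
  have quad z : z != 0 ->
      'X ^+ 2 - c (z + z^-1) * 'X + 1 = ('X - z%:P) * ('X - z^-1%:P).
    move=> z0; have zz : z%:P * z^-1%:P = 1 :> {poly Q} by rewrite -polyCM divff.
    by rewrite -zz /c polyCD; ring.
  by rewrite /rs !big_cons big_nil mulr1 mulrA !quad // mulrA.
have splits : splittingFieldFor 1 (map_poly intr (recip_quartic A B)) {:Q}.
  exists rs; first by rewrite fE eqpxx.
  apply/eqP; rewrite eqEsubv subvf -genQ; apply/Fadjoin_seqP.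
  split; first exact: sub1v.
  move=> z; rewrite !inE => /orP[] /eqP ->; apply: seqv_sub_adjoin;
    by rewrite !inE eqxx ?orbT.
have Q_ax : FieldExt_isSplittingField _ Q.
  constructor; exists (map_poly intr (recip_quartic A B)) => //.
  by apply/polyOverP => i; rewrite coef_map rpred_int.
pose Qs : splittingFieldType rat := HB.pack_for (splittingFieldType rat) Q Q_ax.
exists Qs; first exact: splits.
exact: (@galois_group_D8 Qs A B x1 x2 irr rx1 rx2 sumE genQ nin).
Qed.

(** * The infinite family *)

(** With A = 4 k + 1 and B = -1 - 2 A, W = (4 k + 3)(4 k + 7) and f(-1) = -(16 k + 3). The factors
    of W are odd and differ by 4, hence coprime. *)
Lemma monogenic_D4_family (k : nat) : (0 < k)%N ->
  squarefree (4 * k + 3) -> squarefree (4 * k + 7) -> squarefree (16 * k + 3) ->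
  monogenic_D4_pair (4 * k%:Z + 1) (- 8 * k%:Z - 3).
Proof.
move=> k0 s3 s7 s16; set A := 4 * k%:Z + 1; set B := - 8 * k%:Z - 3.
have a : (A = 1 %[mod 4])%Z by rewrite /A; lia.
have b : (B = 1 %[mod 4])%Z by rewrite /B; lia.
have WE : trace_disc A B = (4 * k%:Z + 3) * (4 * k%:Z + 7) by rewrite /trace_disc /A /B; ring.
split => //.
  apply: monogenic_recip_quartic => //; first by rewrite /A /B; ring.
    have -> : absz (trace_disc A B) = ((4 * k + 3) * (4 * k + 7))%N by rewrite WE; lia.
    apply: squarefreeM => //; rewrite /coprime.
    rewrite (_ : 4 * k + 7 = 4 * k + 3 + 4)%N; last by lia.
    rewrite gcdnDl; have : coprime (4 * k + 3) (2 ^ 2); last by [].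
    by rewrite coprimeXr // coprimen2; lia.
  by have -> : absz (B + 2 - 2 * A)%R = (16 * k + 3)%N by rewrite /A /B; lia.
apply: galois_group_recip_quartic; first exact: recip_quartic_irr.
  by rewrite WE; apply: mulr_gt0; lia.
have -> : rel_disc_norm A B = - (16 * k%:Z + 3) by rewrite /rel_disc_norm /A /B; ring.
lia.
Qed.

Theorem theorem1p2 :
  infinite_set [set AB : int * int | monogenic_D4_pair AB.1 AB.2] /\
  (forall Ai Bi Aj Bj : int,
     monogenic_D4_pair Ai Bi -> monogenic_D4_pair Aj Bj ->
     (Ai, Bi) <> (Aj, Bj) ->
     forall (L : fieldExtType rat) (thetai thetaj : L),
       root (map_poly intr (recip_quartic Ai Bi)) thetai ->
       root (map_poly intr (recip_quartic Aj Bj)) thetaj ->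
       <<1; thetai>>%VS <> <<1; thetaj>>%VS).
Proof.
split; last exact: fields_distinct.
(* A pair from the family with k above every |A| in the list cannot belong to it. *)
move=> /finite_seqP[s sE]; pose bound := (\max_(AB <- s) absz AB.1)%N.
have [k [kb s3 s7 s16]] := sqfree_triples_unbounded bound.+1.
have pair := monogenic_D4_family (leq_ltn_trans (leq0n _) kb) s3 s7 s16.
have : (4 * k%:Z + 1, - 8 * k%:Z - 3) \in s.
  by have : [set` s] (4 * k%:Z + 1, - 8 * k%:Z - 3) by rewrite -sE.
move=> mem; have := leq_bigmax_seq (P := xpredT)
  (F := fun AB : int * int => absz AB.1) _ mem isT.
by rewrite -/bound /=; move: kb; move: (bound) => m; lia.
Qed.
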